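(* Consider the rigid-body attitude dynamics with disturbance $$J\dot\Omega+\Omega\times J\Omega=u+W(R,\Omega)\Delta,\qquad \dot R=R\hat\Omega,$$ with $R\in SO(3)$, $\Omega\in\mathbb{R}^3$, $J\in\mathbb{R}^{3\times3}$ the (symmetric positive definite) inertia matrix with maximum eigenvalue $\lambda_M$, $W:SO(3)\times\mathbb{R}^3\to\mathbb{R}^{3\times p}$ a known function, and $\Delta\in\mathbb{R}^p$ an unknown fixed parameter, where $\|W\|\le B_W$ and $\|\Delta\|\le B_\Delta$ for known constants $B_W,B_\Delta$. Let $r,v\in\mathbb{R}^3$ be unit vectors, $0^\circ\le\theta\le90^\circ$, $\alpha>0$, and $G=\mathrm{diag}(g_1,g_2,g_3)$ with distinct positive $g_i$. Given a desired attitude command $(R_d,\Omega_d=0)$ with $R_d\in SO(3)$ constant and $r^TR_d^Tv<\cos\theta$, and positive constants $k_R,k_\Omega,k_\Delta,c$, define the control input $u\in\mathbb{R}^3$ and the adaptive update law for the estimated uncertainty $\bar\Delta\in\mathbb{R}^p$ by $$u=-k_Re_R-k_\Omega e_\Omega+\Omega\times J\Omega-W\bar\Delta,\qquad \dot{\bar\Delta}=k_\Delta W^T(e_\Omega+c\,e_R),$$ with $e_R,e_\Omega$, the domain $D$ and the constant $H$ as defined in the context. If $c$ is chosen such that $$0<c<\frac{4k_Rk_\Omega}{k_\Omega^2+4k_R\lambda_MH},$$ then, for the closed-loop system with attitude in the domain $D$, the zero equilibrium of the error vectors $(e_R,e_\Omega,e_\Delta)$, where $e_\Delta=\Delta-\bar\Delta$,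 is stable in the sense of Lyapunov. Furthermore, $e_R,e_\Omega\to0$ as $t\to\infty$, and $\bar\Delta$ is uniformly bounded.
   Context: $SO(3)$ is the group of $3\times3$ rotation matrices; $\|\cdot\|$ is the Euclidean norm of vectors, the 2-norm of matrices, and the absolute value of scalars. The hat map $\wedge:\mathbb{R}^3\to\mathfrak{so}(3)$ sends $x$ to the skew-symmetric matrix $\hat x=x^\wedge$ with $\hat xy=x\times y$; its inverse is the vee map $\vee$. Definitions (for $R$ with $r^TR^Tv<\cos\theta$): $A(R)=\frac12\mathrm{tr}[G(I-R_d^TR)]$; $B(R)=1-\frac1\alpha\ln\big(\frac{\cos\theta-r^TR^Tv}{1+\cos\theta}\big)$; $\Psi=AB$; $e_{R_A}=\frac12(GR_d^TR-R^TR_dG)^\vee$; $e_{R_B}=\frac{(R^Tv)^\wedge r}{\alpha(r^TR^Tv-\cos\theta)}$; $e_R=e_{R_A}B+A\,e_{R_B}$; $e_\Omega=\Omega$; $E=\frac12(\mathrm{tr}[R^TR_dG]I-R^TR_dG)$; $F=\frac{1}{\alpha(r^TR^Tv-\cos\theta)}\Big[(v^TRr)I-R^Tv\,r^T+\frac{R^T\hat vRr\,v^TR\hat r}{r^TR^Tv-\cos\theta}\Big]$. Domain: with $h_1=\min\{g_1+g_2,g_2+g_3,g_3+g_1\}$ and fixed constants $\psi<h_1$, $\beta<\cos\theta$, $D=\{R\in SO(3):\Psi(R)<\psi,\ r^TR^Tv<\beta\}$, a domain about the desired attitude $R_d$. Constant $H$: $H=\|B\|\|E\|+2\|e_{R_A}\|\|e_{R_B}\|+\|A\|\|F\|$,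 where each norm stands for a constant upper bound of that quantity over $D$; along $\dot R=R\hat\Omega$ in $D$ this gives $\|\dot e_R\|\le H\|e_\Omega\|$. *)

(* Defs.v *)
From HB Require Import structures.
From mathcomp Require Import all_boot all_order all_algebra.
From mathcomp Require Import all_classical all_reals all_analysis.

Set Implicit Arguments.
Unset Strict Implicit.
Unset Printing Implicit Defensive.

Import Order.TTheory GRing.Theory Num.Theory.
Import numFieldNormedType.Exports.
Local Open Scope classical_set_scope.
Local Open Scope ring_scope.

(* The canonical norm of 'M[R]_(m, n) is the max norm, hence the two norms
   below. *)
Definition enorm (R : realType) (n : nat) (x : 'cV[R]_n) : R :=
  Num.sqrt (\sum_(i < n) x i 0 ^+ 2).

Definition norm2 (R : realType) (m n : nat) (A : 'M[R]_(m, n)) : R :=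
  sup [set enorm (A *m x) | x in [set x : 'cV[R]_n | enorm x <= 1]].

Definition SO3 (R : realType) : set 'M[R]_3 :=
  [set Q | Q *m Q^T = 1%:M /\ \det Q = 1].

Definition pos_def (R : realType) (n : nat) (J : 'M[R]_n) : Prop :=
  J^T = J /\ forall x : 'cV[R]_n, x != 0 -> 0 < (x^T *m J *m x) 0 0.

(* For symmetric J the row eigenvectors used by [eigenvalue] are the transposes
   of the column ones. *)
Definition max_eigenvalue (R : realType) (n : nat) (J : 'M[R]_n) (l : R) : Prop :=
  eigenvalue J l /\ forall a : R, eigenvalue J a -> a <= l.

Definition vec3 (R : realType) (a b c : R) : 'cV[R]_3 :=
  \col_(i < 3) nth 0 [:: a; b; c] i.

Definition cross (R : realType) (x y : 'cV[R]_3) : 'cV[R]_3 :=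
  let X (k : nat) := x (inord k) 0 in
  let Y (k : nat) := y (inord k) 0 in
  vec3 (X 1 * Y 2 - X 2 * Y 1) (X 2 * Y 0 - X 0 * Y 2) (X 0 * Y 1 - X 1 * Y 0).

Definition hat (R : realType) (x : 'cV[R]_3) : 'M[R]_3 :=
  let X (k : nat) := x (inord k) 0 in
  \matrix_(i < 3, j < 3)
    nth 0 (nth [::] [:: [::     0; - X 2;   X 1 ];
                        [::   X 2;     0; - X 0 ];
                        [:: - X 1;   X 0;     0 ]] i) j.

Definition vee (R : realType) (M : 'M[R]_3) : 'cV[R]_3 :=
  vec3 (M (inord 2) (inord 1)) (M (inord 0) (inord 2)) (M (inord 1) (inord 0)).

Lemma hat_cross (R : realType) (x y : 'cV[R]_3) : hat x *m y = cross x y.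
Proof.
apply/matrixP => i j; rewrite (ord1 j) !mxE !big_ord_recr big_ord0 /= !mxE /=.
have -> : widen_ord (leqnSn 2) (widen_ord (leqnSn 1) ord_max) = inord 0 :> 'I_3.
  by apply/val_inj; rewrite /= inordK.
have -> : widen_ord (leqnSn 2) ord_max = inord 1 :> 'I_3.
  by apply/val_inj; rewrite /= inordK.
have -> : ord_max = inord 2 :> 'I_3 by apply/val_inj; rewrite /= inordK.
case: i => [[|[|[|//]]] i3] /=;
  by rewrite ?(mul0r, add0r, addr0, mulNr) // addrC.
Qed.

Lemma hatK (R : realType) : cancel (@hat R) (@vee R).
Proof.
move=> x; apply/matrixP => i j; rewrite (ord1 j) !mxE !inordK //=.
by case: i => [[|[|[|//]]] i3] /=; congr (x _ _); apply/val_inj; rewrite /= inordK.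
Qed.

Lemma veeK (R : realType) (M : 'M[R]_3) : M^T = - M -> hat (vee M) = M.
Proof.
move=> skM.
have sk i j : M j i = - M i j by have /matrixP/(_ i j) := skM; rewrite !mxE.
have diag i : M i i = 0.
  by apply/eqP; have /eqP := sk i i; rewrite -addr_eq0 -mulr2n mulrn_eq0.
have E (k : nat) (i : 'I_3) : nat_of_ord i = k -> inord k = i.
  by move=> <-; rewrite inord_val.
apply/matrixP => i j; have [<-|] := eqVneq i j.
  by rewrite diag mxE; case: i => [[|[|[|//]]] i3].
rewrite !mxE !inordK //=.
case: i => [[|[|[|//]]] i3]; case: j => [[|[|[|//]]] j3] //= _;
  by rewrite -?sk; congr (M _ _); apply: E.
Qed.

Section ErrorVariables.
Context {R : realType}.
Implicit Types (g : 'rV[R]_3) (Rd Q : 'M[R]_3) (r v : 'cV[R]_3) (theta alpha : R).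

Definition rRv r v Q : R := (r^T *m Q^T *m v) 0 0.

Definition err_A g Rd Q : R :=
  2^-1 * \tr (diag_mx g *m (1%:M - Rd^T *m Q)).

Definition err_B r v theta alpha Q : R :=
  1 - alpha^-1 * ln ((cos theta - rRv r v Q) / (1 + cos theta)).

Definition err_Psi g Rd r v theta alpha Q : R :=
  err_A g Rd Q * err_B r v theta alpha Q.

Definition e_RA g Rd Q : 'cV[R]_3 :=
  2^-1 *: vee (diag_mx g *m Rd^T *m Q - Q^T *m Rd *m diag_mx g).

Definition e_RB r v theta alpha Q : 'cV[R]_3 :=
  (alpha * (rRv r v Q - cos theta))^-1 *: (hat (Q^T *m v) *m r).

Definition e_R g Rd r v theta alpha Q : 'cV[R]_3 :=
  err_B r v theta alpha Q *: e_RA g Rd Q + err_A g Rd Q *: e_RB r v theta alpha Q.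

Definition mat_E g Rd Q : 'M[R]_3 :=
  2^-1 *: ((\tr (Q^T *m Rd *m diag_mx g))%:M - Q^T *m Rd *m diag_mx g).

Definition mat_F r v theta alpha Q : 'M[R]_3 :=
  (alpha * (rRv r v Q - cos theta))^-1 *:
    (((v^T *m Q *m r) 0 0)%:M - Q^T *m v *m r^T
     + (rRv r v Q - cos theta)^-1 *:
         ((Q^T *m hat v *m Q *m r) *m (v^T *m Q *m hat r))).

Definition h1 g : R :=
  let G (k : nat) := g 0 (inord k) in
  Num.min (G 0 + G 1) (Num.min (G 1 + G 2) (G 2 + G 0)).

Definition dom_D g Rd r v theta alpha (psi beta : R) : set 'M[R]_3 :=
  [set Q | SO3 Q /\ err_Psi g Rd r v theta alpha Q < psi /\ rRv r v Q < beta].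

End ErrorVariables.

Section ClosedLoop.
Context {R : realType}.

Definition horizon (T : \bar R) : set R := [set t | 0 <= t /\ (t%:E < T)%E].

(* Entrywise, so that it also makes sense for matrices with no column or row,
   which carry no canonical normed structure. *)
Definition mx_derive (m n : nat) (X : R -> 'M[R]_(m, n)) (t : R)
    (dX : 'M[R]_(m, n)) : Prop :=
  forall i j, is_derive t 1 (fun s => X s i j) (dX i j).

(* [X] solves X' = [dX] on [0, T): continuous up to t = 0, differentiable in the
   interior. *)
Definition solves_on (m n : nat) (T : \bar R) (X dX : R -> 'M[R]_(m, n)) : Prop :=
  (forall i j, {within horizon T, continuous (fun t => X t i j)}) /\
  forall t, 0 < t -> (t%:E < T)%E -> mx_derive X t (dX t).

Context (g : 'rV[R]_3) (Rd : 'M[R]_3) (r v : 'cV[R]_3) (theta alpha : R).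
Context (p : nat) (J : 'M[R]_3) (W : 'M[R]_3 -> 'cV[R]_3 -> 'M[R]_(3, p)).
Context (Delta : 'cV[R]_p) (kR kOmega kDelta c : R).

Let eR := e_R g Rd r v theta alpha.

(* As Omega_d = 0, e_Omega is Omega itself, here [w]; [Db] is the estimate of
   Delta. *)
Definition control (Q : 'M[R]_3) (w : 'cV[R]_3) (Db : 'cV[R]_p) : 'cV[R]_3 :=
  - (kR *: eR Q) - kOmega *: w + cross w (J *m w) - W Q w *m Db.

Definition update_law (Q : 'M[R]_3) (w : 'cV[R]_3) : 'cV[R]_p :=
  kDelta *: ((W Q w)^T *m (w + c *: eR Q)).

(* Solutions on [0, T), 0 < T <= +oo, with state in the set where the error
   variables are defined. *)
Definition closed_loop (T : \bar R) (Q : R -> 'M[R]_3) (w : R -> 'cV[R]_3)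
    (Db : R -> 'cV[R]_p) : Prop :=
  [/\ forall t, horizon T t -> SO3 (Q t) /\ rRv r v (Q t) < cos theta,
      solves_on T Q (fun t => Q t *m hat (w t)),
      exists2 dw : R -> 'cV[R]_3, solves_on T w dw &
        forall t, 0 < t -> (t%:E < T)%E ->
          J *m dw t + cross (w t) (J *m w t)
          = control (Q t) (w t) (Db t) + W (Q t) (w t) *m Delta
    & solves_on T Db (fun t => update_law (Q t) (w t))].

(* The stacked error vector (e_R, e_Omega, e_Delta). *)
Definition error_vector (Q : 'M[R]_3) (w : 'cV[R]_3) (Db : 'cV[R]_p)
    : 'cV[R]_(3 + (3 + p)) :=
  col_mx (eR Q) (col_mx w (Delta - Db)).

End ClosedLoop.

(* Main.v *)
(* With V = w.Jw / 2 + kR Psi + c (Jw).e_R + |e_Delta|^2 / (2 kDelta), the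
   adaptation law cancels the uncertainty and the kinematics [e_R_rate] give
   V' <= - kOmega |w|^2 - c kR |e_R|^2 + c kOmega |w| |e_R| + c lambdaM H |w|^2
   over the domain, a negative definite form under the bound on c.

   V need not be positive over the whole domain.  It is bounded below there, which
   is enough for the convergence and for the bound on the estimate.  For
   stability, Psi is close to B(Rd) times a quadratic form with Hessian E near
   Rd, so that |e_R|^2 <= 2 H' Psi for any H' > H on a sublevel set of A, while the
   bound on c gives c^2 lambdaM H < kR by AM-GM; hence V is equivalent to the
   squared error there, and this sublevel set cannot be left. *)
Require Import Defs.
From HB Require Import structures.
From mathcomp Require Import all_boot all_order all_algebra.
From mathcomp Require Import all_classical all_reals all_analysis.
From mathcomp Require Import ring lra.

Set Implicit Arguments.
Unset Strict Implicit.
Unset Printing Implicit Defensive.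

Import Order.TTheory GRing.Theory Num.Theory.
Import numFieldNormedType.Exports.
Local Open Scope classical_set_scope.
Local Open Scope ring_scope.

(** * Real functions *)

(** A small error vector does not by itself put the attitude near [Rd]: [e_R] is the gradient of Psi
    in the body frame and may vanish at other critical points. Closeness of the initial attitude is
    therefore a separate condition, with a radius fixed before the tolerance on the errors. The loss
    from H to H' comes from the summand A e_RB of e_R. It is of second order in the deviation, since
    A is, but splitting it off by Young's inequality costs an arbitrarily small factor; the strict
    bound on c leaves room for it. In this comparison with Psi only the product of the bounds of B
    and E enters, while the rate of e_R takes the full sum H. Solutions may live on a finite horizon
    and are merely continuous at time 0, so the bound on V' is used through the mean value theorem,
    as a drop of V over an interval. *)

Section RealAnalysis.
Context {R : realType}.

(** The intermediate value theorem is applied up to the infimum of the times with [eta <= h]. The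
    point it yields need not be shown to be that infimum: lying at or before it is enough. *)
Lemma first_exit (h : R -> R) (b eta : R) : 0 <= b ->
  {within `[0, b], continuous h} -> h 0 < eta -> eta <= h b ->
  exists s : R, [/\ 0 <= s <= b, h s = eta & forall u, 0 <= u < s -> h u < eta].
Proof.
move=> b0 hc h0 hb.
pose S := [set s | 0 <= s <= b /\ eta <= h s].
have Sb : S b by split; rewrite ?b0 ?lexx.
have lS : lbound S 0 by move=> s [/andP[]].
have iS : has_inf S by split; [exists b|exists 0].
have is0 : 0 <= inf S by apply: lb_le_inf lS; exists b.
have isb : inf S <= b by apply: ge_inf Sb; exists 0.
have before u : 0 <= u < inf S -> h u < eta.
  move=> /andP[u0 us]; rewrite ltNge; apply/negP => hu.
  have : inf S <= u.
    by apply: ge_inf; [exists 0|split => //; rewrite u0 (le_trans (ltW us))].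
  by rewrite leNgt us.
(* Otherwise [h < eta] near the infimum, against the points of [S] arbitrarily close to it. *)
have at_inf : eta <= h (inf S).
  rewrite leNgt; apply/negP => hs.
  have /subspace_continuousP/(_ (inf S)) := hc.
  rewrite /= in_itv /= is0 isb => /(_ isT)/cvgr_lt/(_ eta hs).
  rewrite near_withinE => /nbhs_ballP[e /= e0 he].
  have [u [/andP[u0 ub] hu] us] := inf_adherent e0 iS.
  have su : inf S <= u by apply: ge_inf; [exists 0|split; rewrite ?u0].
  suff : h u < eta by rewrite ltNge hu.
  apply: he; last by rewrite /= in_itv /= u0.
  by rewrite -ball_normE /ball_ /= ler0_norm ?subr_le0// opprB ltrBlDl.
have hc' : {within `[0, inf S], continuous h}.
  by apply: continuous_subspaceW hc; apply: subset_itvl; rewrite bnd_simp.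
have [|s] := @IVT _ h 0 (inf S) eta is0 hc'.
  by rewrite ge_min (ltW h0) le_max at_inf orbT.
rewrite in_itv /= => /andP[s0 si] hs.
exists s; split=> //; first by rewrite s0 (le_trans si).
by move=> u /andP[u0 us]; apply: before; rewrite u0 (lt_le_trans us).
Qed.

(* A dissipation inequality [V' <= - k f] in integrated form, with [f >= 0]
   Lipschitz and [V] bounded below, forces [f] to vanish at infinity: each time
   [f] reaches [e], [V] drops by a fixed amount. *)
Lemma dissipation_cvg0 (V f : R -> R) (k L C : R) : 0 < k -> 0 < L ->
  (forall a b m, 0 <= a <= b -> (forall s, a < s < b -> m <= f s) ->
    V b <= V a - k * m * (b - a)) ->
  (forall t, 0 <= t -> C <= V t) ->
  (forall s t, 0 < s <= t -> `|f t - f s| <= L * (t - s)) ->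
  (forall t, 0 <= f t) ->
  forall e, 0 < e -> exists2 N, 0 < N & forall t, N <= t -> f t < e.
Proof.
move=> k0 L0 drop lbV lip f0 e e0.
pose S := [set V t | t in [set t : R | 0 <= t]].
have iS : has_inf S.
  by split; [exists (V 0), 0 => /=|exists C => _ [t /= t0 <-]; exact: lbV].
(* During a time [h] the function [f] loses at most [e / 2], so it stays above [e / 2]. *)
pose h := e / (2 * L).
have h0 : 0 < h by rewrite divr_gt0// mulr_gt0.
have d0 : 0 < k * (e / 2) * h by rewrite mulr_gt0// mulr_gt0// divr_gt0.
have [_ [t /= t0 <-] Vt] := inf_adherent d0 iS.
(* From [t] on, [V] is within one such drop of its infimum. Adding 1 keeps the times positive, where
   the Lipschitz bound holds. *)
exists (t + 1); first by rewrite ltr_wpDl.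
move=> u tu; rewrite ltNge; apply/negP => fu.
have u0 : 0 < u by rewrite (lt_le_trans _ tu)// ltr_wpDl.
have tu' : t <= u by rewrite (le_trans _ tu)// lerDl.
have Vu : V u <= V t.
  by have := @drop t u 0; rewrite t0 tu' mulr0 mul0r subr0; apply.
have Vuh : V (u + h) <= V u - k * (e / 2) * h.
  have := @drop u (u + h) (e / 2); rewrite (ltW u0) lerDl (ltW h0) [u + h - u]addrC addKr.
  apply=> // s /andP[us sh]; have := @lip u s; rewrite u0 (ltW us) => /(_ isT).
  have : L * (s - u) <= e / 2.
    have -> : e / 2 = L * h by rewrite /h; field; rewrite gt_eqF.
    by rewrite ler_pM2l// lerBlDl ltW.
  rewrite ler_norml => Ls /andP[]; lra.
have : inf S <= V (u + h).
  by apply: (ge_inf iS.2); exists (u + h) => //=; rewrite addr_ge0 ?ltW.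
lra.
Qed.

End RealAnalysis.

(** * Euclidean and spectral norms *)

Section EuclideanSpace.
Context {R : realType}.

Definition dot n (x y : 'cV[R]_n) : R := \sum_i x i 0 * y i 0.

Lemma dotE n (x y : 'cV[R]_n) : dot x y = (x^T *m y) 0 0.
Proof. by rewrite mxE; apply: eq_bigr => i _; rewrite mxE. Qed.

Lemma dotC n (x y : 'cV[R]_n) : dot x y = dot y x.
Proof. by apply: eq_bigr => i _; rewrite mulrC. Qed.

Lemma dotDl n (x y z : 'cV[R]_n) : dot (x + y) z = dot x z + dot y z.
Proof. by rewrite -big_split; apply: eq_bigr => i _; rewrite mxE mulrDl. Qed.

Lemma dotZl n (a : R) (x y : 'cV[R]_n) : dot (a *: x) y = a * dot x y.
Proof. by rewrite mulr_sumr; apply: eq_bigr => i _; rewrite mxE mulrA. Qed.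

Lemma dotDr n (x y z : 'cV[R]_n) : dot x (y + z) = dot x y + dot x z.
Proof. by rewrite dotC dotDl !(dotC x). Qed.

Lemma dotZr n (a : R) (x y : 'cV[R]_n) : dot x (a *: y) = a * dot x y.
Proof. by rewrite dotC dotZl (dotC x). Qed.

Lemma dotNr n (x y : 'cV[R]_n) : dot x (- y) = - dot x y.
Proof. by rewrite -scaleN1r dotZr mulN1r. Qed.

Lemma dotNl n (x y : 'cV[R]_n) : dot (- x) y = - dot x y.
Proof. by rewrite dotC dotNr dotC. Qed.

Lemma dot0l n (x : 'cV[R]_n) : dot 0 x = 0.
Proof. by rewrite -(scale0r 0) dotZl mul0r. Qed.

Lemma dot_mulmxl m n (A : 'M[R]_(m, n)) (x : 'cV[R]_n) (y : 'cV[R]_m) :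
  dot (A *m x) y = dot x (A^T *m y).
Proof. by rewrite !dotE trmx_mul mulmxA. Qed.

Lemma dot_ge0 n (x : 'cV[R]_n) : 0 <= dot x x.
Proof. by apply: sumr_ge0 => i _; rewrite -expr2 sqr_ge0. Qed.

Lemma dot_eq0 n (x : 'cV[R]_n) : dot x x = 0 -> x = 0.
Proof.
move/eqP; rewrite psumr_eq0 => [|i _]; last by rewrite -expr2 sqr_ge0.
move/allP => x0; apply/matrixP => i j; rewrite ord1 mxE.
by have := x0 i (mem_index_enum i); rewrite /= mulf_eq0 orbb => /eqP.
Qed.

Lemma sqr_enorm n (x : 'cV[R]_n) : enorm x ^+ 2 = dot x x.
Proof.
rewrite /enorm sqr_sqrtr; last by apply: sumr_ge0 => i _; rewrite sqr_ge0.
by apply: eq_bigr => i _; rewrite expr2.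
Qed.

Lemma enorm_ge0 n (x : 'cV[R]_n) : 0 <= enorm x.
Proof. exact: sqrtr_ge0. Qed.

Lemma enorm_dot n (x : 'cV[R]_n) : enorm x = Num.sqrt (dot x x).
Proof. by rewrite -sqr_enorm sqrtr_sqr ger0_norm ?enorm_ge0. Qed.

Lemma enorm_eq0 n (x : 'cV[R]_n) : enorm x = 0 -> x = 0.
Proof. by move=> x0; apply: dot_eq0; rewrite -sqr_enorm x0 expr0n. Qed.

Lemma enormZ n (a : R) (x : 'cV[R]_n) : enorm (a *: x) = `|a| * enorm x.
Proof.
apply: (@pexpIrn _ 2) => //; rewrite ?nnegrE ?mulr_ge0 ?enorm_ge0//.
by rewrite exprMn !sqr_enorm dotZl dotZr real_normK ?num_real// mulrA expr2.
Qed.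

(** The values at [(d, - b)] and [(b, - a)] are [d] and [a] times [a * d - b ^+ 2]. Their sum only
    asks for a division by [a + d], and [a + d = 0] forces all three coefficients to vanish. *)
Lemma quad_form_disc (a b d : R) :
  (forall s t : R, 0 <= s ^+ 2 * a + 2 * s * t * b + t ^+ 2 * d) ->
  b ^+ 2 <= a * d.
Proof.
move=> h; have := h d (- b); have := h b (- a); have := h 1 0; have := h 0 1.
have := h 1 1; have := h 1 (- 1).
rewrite !expr0n !expr1n /= => h1 h2 h3 h4 h5 h6.
have a0 : 0 <= a by lra.
have d0 : 0 <= d by lra.
have [ad|ad] := eqVneq (a + d) 0.
  have -> : a = 0 by lra.
  have -> : d = 0 by lra.
  have -> : b = 0 by lra.
  lra.
have ad0 : 0 < a + d by rewrite lt_def ad addr_ge0.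
rewrite -subr_ge0 -(pmulr_rge0 _ ad0).
have -> : (a + d) * (a * d - b ^+ 2) =
  (b ^+ 2 * a + 2 * b * - a * b + (- a) ^+ 2 * d) +
  (d ^+ 2 * a + 2 * d * - b * b + (- b) ^+ 2 * d) by ring.
exact: addr_ge0.
Qed.

(** Semidefiniteness has to suffice: one instance is the singular matrix [m%:M - J], with [m] the
    maximum of the Rayleigh quotient. *)
Lemma psd_CauchySchwarz n (M : 'M[R]_n) (x y : 'cV[R]_n) :
  M^T = M -> (forall z, 0 <= dot z (M *m z)) ->
  dot x (M *m y) ^+ 2 <= dot x (M *m x) * dot y (M *m y).
Proof.
move=> sM psM; apply: quad_form_disc => s t.
have -> : s ^+ 2 * dot x (M *m x) + 2 * s * t * dot x (M *m y)
          + t ^+ 2 * dot y (M *m y)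
        = dot (s *: x + t *: y) (M *m (s *: x + t *: y)).
  rewrite mulmxDr -!scalemxAr !(dotDl, dotDr, dotZl, dotZr).
  by rewrite (dotC y (M *m x)) dot_mulmxl sM; ring.
exact: psM.
Qed.

Lemma CauchySchwarz n (x y : 'cV[R]_n) : dot x y ^+ 2 <= dot x x * dot y y.
Proof.
have := @psd_CauchySchwarz n 1%:M x y (trmx1 _ _); rewrite !mul1mx; apply => z.
by rewrite mul1mx dot_ge0.
Qed.

Lemma ler_norm_dot n (x y : 'cV[R]_n) : `|dot x y| <= enorm x * enorm y.
Proof.
rewrite -(@ler_pXn2r _ 2) ?nnegrE ?mulr_ge0 ?enorm_ge0//.
by rewrite real_normK ?num_real// exprMn !sqr_enorm CauchySchwarz.
Qed.

Lemma ler_dot n (x y : 'cV[R]_n) : dot x y <= enorm x * enorm y.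
Proof. exact: le_trans (ler_norm _) (ler_norm_dot _ _). Qed.

Lemma ler_enormD n (x y : 'cV[R]_n) : enorm (x + y) <= enorm x + enorm y.
Proof.
rewrite -(@ler_pXn2r _ 2) ?nnegrE ?addr_ge0 ?enorm_ge0//.
rewrite sqrrD !sqr_enorm !(dotDl, dotDr) (dotC y x).
have := ler_dot x y; lra.
Qed.

Lemma enormN n (x : 'cV[R]_n) : enorm (- x) = enorm x.
Proof. by rewrite -scaleN1r enormZ normrN1 mul1r. Qed.

Lemma ler_entry_enorm n (x : 'cV[R]_n) i : `|x i 0| <= enorm x.
Proof.
rewrite -(@ler_pXn2r _ 2) ?nnegrE ?enorm_ge0// real_normK ?num_real//.
rewrite sqr_enorm /dot (bigD1 i)//= expr2 lerDl.
by apply: sumr_ge0 => j _; rewrite -expr2 sqr_ge0.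
Qed.

Lemma ler_enorm_sum n (x : 'cV[R]_n) : enorm x <= \sum_i `|x i 0|.
Proof.
have s0 : 0 <= \sum_i `|x i 0| by exact: sumr_ge0.
rewrite -(@ler_pXn2r _ 2) ?nnegrE ?enorm_ge0// sqr_enorm.
rewrite expr2 mulr_suml; apply: ler_sum => i _.
rewrite (le_trans (ler_norm _))// normrM ler_wpM2l//.
by rewrite (bigD1 i)//= lerDl sumr_ge0.
Qed.

(** Makes the [sup] in [norm2] a genuine supremum rather than a default value. *)
Lemma norm2_has_sup m n (A : 'M[R]_(m, n)) :
  has_sup [set enorm (A *m x) | x in [set x : 'cV[R]_n | enorm x <= 1]].
Proof.
split.
  by exists (enorm (A *m 0)), 0 => //=; rewrite enorm_dot dot0l sqrtr0.
exists (\sum_i \sum_j `|A i j|) => _ [x /= x1 <-].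
rewrite (le_trans (ler_enorm_sum _))// ler_sum// => i _.
rewrite mxE (le_trans (ler_norm_sum _ _ _))// ler_sum// => j _.
by rewrite normrM ler_piMr// (le_trans (ler_entry_enorm _ _)).
Qed.

Lemma ler_norm2 m n (A : 'M[R]_(m, n)) (x : 'cV[R]_n) :
  enorm (A *m x) <= norm2 A * enorm x.
Proof.
have [x0|x0] := eqVneq (enorm x) 0.
  by rewrite (enorm_eq0 x0) mulmx0 !enorm_dot !dot0l sqrtr0 mulr0.
have xp : 0 < enorm x by rewrite lt_def x0 enorm_ge0.
rewrite -ler_pdivrMr// mulrC -[X in X * _]gtr0_norm ?invr_gt0// -enormZ.
rewrite scalemxAr; apply: (ub_le_sup (norm2_has_sup A).2).
by exists ((enorm x)^-1 *: x) => //=; rewrite enormZ gtr0_norm ?invr_gt0// mulVf.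
Qed.

Lemma norm2_ge0 m n (A : 'M[R]_(m, n)) : 0 <= norm2 A.
Proof.
apply: (ub_le_sup (norm2_has_sup A).2); exists 0 => /=.
  by rewrite enorm_dot dot0l sqrtr0.
by rewrite mulmx0 enorm_dot dot0l sqrtr0.
Qed.

Lemma enorm_delta n (j : 'I_n) : enorm (delta_mx j 0 : 'cV[R]_n) = 1.
Proof.
rewrite enorm_dot /dot (bigD1 j)//= big1 => [|i ij].
  by rewrite !mxE !eqxx mulr1 addr0 sqrtr1.
by rewrite !mxE (negbTE ij) mul0r.
Qed.

Lemma ler_entry_norm2 m n (A : 'M[R]_(m, n)) i j : `|A i j| <= norm2 A.
Proof.
have := ler_norm2 A (delta_mx j 0); rewrite enorm_delta mulr1 -colE.
by apply: le_trans; have := ler_entry_enorm (col j A) i; rewrite mxE.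
Qed.

End EuclideanSpace.

(** * Inertia matrix *)

Section Limits.
Context {R : realType}.

Lemma cvg_sumr {T : Type} (F : set_system T) n (f : 'I_n -> T -> R)
    (a : 'I_n -> R) {FF : Filter F} :
  (forall i, f i x @[x --> F] --> a i) ->
  \sum_i f i x @[x --> F] --> \sum_i a i.
Proof. by move=> fa; apply: cvg_big => //; exact: add_continuous. Qed.

End Limits.

Section Inertia.
Context {R : realType} (n : nat).
Implicit Types (M J : 'M[R]_n) (x w : 'cV[R]_n).

(** Row vectors are used to fit [rV_compact] and [EVT_max_rV]. *)
Lemma quad_form_continuous M :
  continuous (fun x : 'rV[R]_n => dot x^T (M *m x^T)).
Proof.
have -> : (fun x : 'rV[R]_n => dot x^T (M *m x^T)) =
          (fun x : 'rV[R]_n => \sum_i x 0 i * \sum_j (M i j * x 0 j)).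
  apply/funext => x; apply: eq_bigr => i _; rewrite !mxE; congr (_ * _).
  by apply: eq_bigr => j _; rewrite mxE.
move=> x; apply: (cvg_sumr (FF := nbhs_filter x)) => i.
apply: cvgM; first exact: coord_continuous.
apply: (cvg_sumr (FF := nbhs_filter x)) => j.
by apply: cvgM; [exact: cvg_cst|exact: coord_continuous].
Qed.

Lemma unit_sphere_compact : compact [set x : 'rV[R]_n | dot x^T x^T = 1].
Proof.
have cube : compact
    [set v : 'rV[R]_n | forall i, v ord0 i \in `[(- 1), (1:R)]].
  apply: (@rV_compact R  _ (fun=> `[(- 1), (1 : R)]%classic)).
  by move=> _; apply: segment_compact.
apply: (subclosed_compact _ cube) => [|x /= x1 i].
  have -> : [set x : 'rV[R]_n | dot x^T x^T = 1] =
      (fun x : 'rV[R]_n => dot x^T (1%:M *m x^T)) @^-1` [set 1].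
    by apply/seteqP; split => x /=; rewrite mul1mx.
  apply: closed_comp; last exact: closed_eq.
  by move=> x _; exact: quad_form_continuous.
rewrite in_itv /= -ler_norml -[leRHS](@sqrtr1 R) -x1 -enorm_dot.
by have := ler_entry_enorm x^T i; rewrite mxE.
Qed.

(* The maximum of the Rayleigh quotient is attained at an eigenvector. *)
Lemma ler_quad_form_max_eigenvalue J l x : J^T = J -> max_eigenvalue J l ->
  dot x (J *m x) <= l * dot x x.
Proof.
move=> sJ [_ lmax].
have scale_unit y : enorm y != 0 -> dot ((enorm y)^-1 *: y) ((enorm y)^-1 *: y) = 1.
  by move=> y0; rewrite dotZl dotZr -sqr_enorm mulrA -expr2 exprVn mulVf ?expf_neq0.
have [x0|x0] := eqVneq (enorm x) 0.
  by rewrite (enorm_eq0 x0) mulmx0 !dot0l mulr0.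
have S0 : [set x : 'rV[R]_n | dot x^T x^T = 1] !=set0.
  by exists ((enorm x)^-1 *: x)^T; rewrite /= trmxK scale_unit.
have [|y yS ymax] := EVT_max_rV (f := fun x : 'rV[R]_n => dot x^T (J *m x^T))
    S0 unit_sphere_compact.
  exact/continuous_subspaceT/quad_form_continuous.
rewrite inE /= in yS.
set m := dot y^T (J *m y^T) in ymax.
have mmax z : dot z (J *m z) <= m * dot z z.
  have [z0|z0] := eqVneq (enorm z) 0.
    by rewrite (enorm_eq0 z0) mulmx0 !dot0l mulr0.
  have := ymax ((enorm z)^-1 *: z)^T.
  rewrite inE /= trmxK scale_unit// => /(_ erefl).
  rewrite -scalemxAr dotZl dotZr -sqr_enorm mulrA -expr2 exprVn mulrC.
  by rewrite ler_pdivrMr// exprn_gt0// lt_def z0 enorm_ge0.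
have mJ z : dot z ((m%:M - J) *m z) = m * dot z z - dot z (J *m z).
  by rewrite mulmxBl mul_scalar_mx dotDr dotZr dotNr.
(* [m%:M - J] is semidefinite and its form vanishes at the maximiser, so Cauchy-Schwarz makes the
   image of the maximiser orthogonal to itself. *)
have : (m%:M - J) *m y^T = 0.
  apply: dot_eq0; apply/eqP; rewrite -sqrf_eq0 -[_ == 0]andTb eq_le sqr_ge0 andbT.
  have := @psd_CauchySchwarz _ _ (m%:M - J) ((m%:M - J) *m y^T) y^T.
  rewrite [dot y^T _]mJ yS mulr1 subrr mulr0 !linearB /= tr_scalar_mx sJ.
  by apply => // z; rewrite mJ subr_ge0.
rewrite mulmxBl mul_scalar_mx => /eqP; rewrite subr_eq0 => /eqP ey.
have /lmax ml : eigenvalue J m.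
  apply/eigenvalueP; exists y.
    by apply: trmx_inj; rewrite trmx_mul sJ linearZ.
  apply: contraTneq (oner_neq0 R) => y0.
  by rewrite -yS y0 trmx0 dot0l eqxx.
by apply: le_trans (mmax x) _; rewrite ler_wpM2r ?dot_ge0.
Qed.

Lemma pos_def_psd J x : pos_def J -> 0 <= dot x (J *m x).
Proof.
move=> [_ pJ]; have [->|x0] := eqVneq x 0; first by rewrite dot0l.
by rewrite dotE mulmxA ltW// pJ.
Qed.

Lemma max_eigenvalue_gt0 J l : pos_def J -> max_eigenvalue J l -> 0 < l.
Proof.
move=> [sJ pJ] lJ; have [/eigenvalueP[v ev v0] _] := lJ.
have vT0 : v^T != 0 by rewrite trmx_eq0.
have := ler_quad_form_max_eigenvalue v^T sJ lJ.
have := pJ _ vT0; rewrite -mulmxA -dotE => /lt_le_trans h /h.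
by rewrite pmulr_lgt0// lt_def dot_ge0 andbT; apply: contra vT0 => /eqP/dot_eq0 ->.
Qed.

(** Cauchy-Schwarz for the form [J] at [J *m x] and [x], then the Rayleigh bound at [J *m x]; one
    factor |J x|^2 cancels. *)
Lemma sqr_enorm_mulmx_le J l x : pos_def J -> max_eigenvalue J l ->
  dot (J *m x) (J *m x) <= l * dot x (J *m x).
Proof.
move=> pJ lJ; have l0 := max_eigenvalue_gt0 pJ lJ; have sJ := pJ.1.
have [z|z0] := eqVneq (dot (J *m x) (J *m x)) 0.
  by rewrite z mulr_ge0 ?pos_def_psd// ltW.
have zp : 0 < dot (J *m x) (J *m x) by rewrite lt_def z0 dot_ge0.
rewrite -(ler_pM2l zp) -expr2.
apply: le_trans (psd_CauchySchwarz (J *m x) x sJ (fun z => pos_def_psd z pJ)) _.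
rewrite mulrA [_ * l]mulrC ler_wpM2r ?pos_def_psd//.
exact: ler_quad_form_max_eigenvalue.
Qed.

Lemma ler_enorm_max_eigenvalue J l x : pos_def J -> max_eigenvalue J l ->
  enorm (J *m x) <= l * enorm x.
Proof.
move=> pJ lJ; have l0 := max_eigenvalue_gt0 pJ lJ.
rewrite -(@ler_pXn2r _ 2) ?nnegrE ?mulr_ge0 ?enorm_ge0 ?(ltW l0)//.
rewrite exprMn !sqr_enorm; apply: le_trans (sqr_enorm_mulmx_le x pJ lJ) _.
rewrite expr2 -mulrA ler_wpM2l ?(ltW l0)//.
exact: ler_quad_form_max_eigenvalue pJ.1 lJ.
Qed.

Lemma pos_def_unitmx J : pos_def J -> J \in unitmx.
Proof.
move=> [sJ pJ]; rewrite unitmxE unitfE; apply/negP => /det0P[v v0 vJ].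
have vT0 : v^T != 0 by rewrite trmx_eq0.
have := pJ _ vT0; rewrite trmxK vJ mul0mx mxE ltxx //.
Qed.

(** Follows from |x| <= |J^-1| |J x| and [sqr_enorm_mulmx_le], with no recourse to a smallest
    eigenvalue. *)
Lemma pos_def_coercive J l : pos_def J -> max_eigenvalue J l ->
  exists2 m : R, 0 < m & forall x, m * dot x x <= dot x (J *m x).
Proof.
move=> pJ lJ; have l0 := max_eigenvalue_gt0 pJ lJ.
pose N := norm2 (invmx J) + 1.
have N0 : 0 < N by rewrite ltr_pwDr// norm2_ge0.
exists (N ^+ 2 * l)^-1; first by rewrite invr_gt0 mulr_gt0// exprn_gt0.
move=> x; rewrite mulrC ler_pdivrMr ?mulr_gt0 ?exprn_gt0//.
rewrite mulrC -mulrA; apply: le_trans (_ : N ^+ 2 * dot (J *m x) (J *m x) <= _).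
  rewrite -!sqr_enorm -exprMn ler_pXn2r ?nnegrE ?mulr_ge0 ?enorm_ge0 ?(ltW N0)//.
  rewrite -{1}[x](mulKmx (pos_def_unitmx pJ)) (le_trans (ler_norm2 _ _))//.
  by rewrite ler_wpM2r ?enorm_ge0// /N lerDl.
by rewrite ler_wpM2l ?sqr_ge0// sqr_enorm_mulmx_le.
Qed.

End Inertia.

(** * Coordinates in dimension three *)

Section Coordinates.
Context {R : realType}.

Local Notation o0 := (inord 0 : 'I_3).
Local Notation o1 := (inord 1 : 'I_3).
Local Notation o2 := (inord 2 : 'I_3).

Lemma ord3P (P : 'I_3 -> Prop) : P o0 -> P o1 -> P o2 -> forall i, P i.
Proof.
move=> P0 P1 P2 i; rewrite -[i]inord_val.
by case: i => [[|[|[|//]]] i3].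
Qed.

Lemma sum3E (F : 'I_3 -> R) : \sum_i F i = F o0 + F o1 + F o2.
Proof.
rewrite !big_ord_recr big_ord0 /= add0r.
by congr (F _ + F _ + F _); apply: val_inj; rewrite /= inordK.
Qed.

Lemma eq_ord3 : ((o0 == o1) = false) * ((o0 == o2) = false)
  * ((o1 == o0) = false) * ((o1 == o2) = false)
  * ((o2 == o0) = false) * ((o2 == o1) = false).
Proof. by do !split; rewrite -val_eqE /= !inordK. Qed.

Lemma det3E (A : 'M[R]_3) : \det A =
  A o0 o0 * (A o1 o1 * A o2 o2 - A o1 o2 * A o2 o1)
  - A o0 o1 * (A o1 o0 * A o2 o2 - A o1 o2 * A o2 o0)
  + A o0 o2 * (A o1 o0 * A o2 o1 - A o1 o1 * A o2 o0).
Proof.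
rewrite (expand_det_row _ ord0) !big_ord_recl big_ord0 /cofactor.
rewrite !(expand_det_row _ ord0) !big_ord_recl !big_ord0 /cofactor !det_mx11 !mxE.
pose a k l := A (inord k) (inord l).
have AE i j : A i j = a i j by rewrite /a !inord_val.
rewrite !AE /= !inordK // /bump /= !(addn0, add0n) addn1.
by ring.
Qed.

Lemma SO3_mulTmx (Q : 'M[R]_3) : SO3 Q -> Q^T *m Q = 1%:M.
Proof. by case=> /mulmx1C. Qed.

Lemma mulmx3E m n (A : 'M[R]_(m, 3)) (B : 'M[R]_(3, n)) i j :
  (A *m B) i j = A i o0 * B o0 j + A i o1 * B o1 j + A i o2 * B o2 j.
Proof. by rewrite mxE sum3E. Qed.

Lemma mulmx1E m n (A : 'M[R]_(m, 1)) (B : 'M[R]_(1, n)) i j :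
  (A *m B) i j = A i 0 * B 0 j.
Proof. by rewrite mxE big_ord1. Qed.

Lemma addmxE m n (A B : 'M[R]_(m, n)) i j : (A + B) i j = A i j + B i j.
Proof. by rewrite mxE. Qed.

Lemma oppmxE m n (A : 'M[R]_(m, n)) i j : (- A) i j = - A i j.
Proof. by rewrite mxE. Qed.

Lemma scalemxE m n a (A : 'M[R]_(m, n)) i j : (a *: A) i j = a * A i j.
Proof. by rewrite mxE. Qed.

Lemma trmxE m n (A : 'M[R]_(m, n)) i j : A^T i j = A j i.
Proof. by rewrite mxE. Qed.

Lemma scalar_mx3E (a : R) : ((a%:M o0 o0 = a) * (a%:M o1 o1 = a)
  * (a%:M o2 o2 = a) * (a%:M o0 o1 = 0) * (a%:M o0 o2 = 0) * (a%:M o1 o0 = 0)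
  * (a%:M o1 o2 = 0) * (a%:M o2 o0 = 0) * (a%:M o2 o1 = 0))%type.
Proof. by do !split; rewrite mxE ?eqxx ?eq_ord3. Qed.

Lemma diag_mx3E (a : 'rV[R]_3) : ((diag_mx a o0 o0 = a 0 o0)
  * (diag_mx a o1 o1 = a 0 o1) * (diag_mx a o2 o2 = a 0 o2)
  * (diag_mx a o0 o1 = 0) * (diag_mx a o0 o2 = 0) * (diag_mx a o1 o0 = 0)
  * (diag_mx a o1 o2 = 0) * (diag_mx a o2 o0 = 0) * (diag_mx a o2 o1 = 0))%type.
Proof. by do !split; rewrite mxE ?eqxx ?eq_ord3. Qed.

Lemma hatE (x : 'cV[R]_3) : ((hat x o0 o0 = 0) * (hat x o1 o1 = 0)
  * (hat x o2 o2 = 0) * (hat x o0 o1 = - x o2 0) * (hat x o0 o2 = x o1 0)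
  * (hat x o1 o0 = x o2 0) * (hat x o1 o2 = - x o0 0) * (hat x o2 o0 = - x o1 0)
  * (hat x o2 o1 = x o0 0))%type.
Proof. by do !split; rewrite mxE !inordK. Qed.

Lemma veeE (M : 'M[R]_3) : ((vee M o0 0 = M o2 o1) * (vee M o1 0 = M o0 o2)
  * (vee M o2 0 = M o1 o0))%type.
Proof. by do !split; rewrite mxE !inordK. Qed.

Lemma crossE (x y : 'cV[R]_3) :
  ((cross x y o0 0 = x o1 0 * y o2 0 - x o2 0 * y o1 0)
  * (cross x y o1 0 = x o2 0 * y o0 0 - x o0 0 * y o2 0)
  * (cross x y o2 0 = x o0 0 * y o1 0 - x o1 0 * y o0 0))%type.
Proof. by do !split; rewrite mxE !inordK. Qed.

Lemma dot3E (x y : 'cV[R]_3) :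
  dot x y = x o0 0 * y o0 0 + x o1 0 * y o1 0 + x o2 0 * y o2 0.
Proof. exact: sum3E. Qed.

Lemma tr3E (M : 'M[R]_3) : \tr M = M o0 o0 + M o1 o1 + M o2 o2.
Proof. exact: sum3E. Qed.

Definition coordE := (mulmx3E, mulmx1E, addmxE, oppmxE, scalemxE, trmxE,
  scalar_mx3E, diag_mx3E, hatE, veeE, crossE, dot3E, tr3E).

Lemma cV3P (x y : 'cV[R]_3) :
  x o0 0 = y o0 0 -> x o1 0 = y o1 0 -> x o2 0 = y o2 0 -> x = y.
Proof.
by move=> h0 h1 h2; apply/matrixP; elim/ord3P => j; rewrite ord1.
Qed.

Lemma mx3P (A B : 'M[R]_3) :
  [/\ A o0 o0 = B o0 o0, A o0 o1 = B o0 o1 & A o0 o2 = B o0 o2] ->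
  [/\ A o1 o0 = B o1 o0, A o1 o1 = B o1 o1 & A o1 o2 = B o1 o2] ->
  [/\ A o2 o0 = B o2 o0, A o2 o1 = B o2 o1 & A o2 o2 = B o2 o2] -> A = B.
Proof.
by move=> [? ? ?] [? ? ?] [? ? ?]; apply/matrixP; elim/ord3P; elim/ord3P.
Qed.

Lemma hat_tr (w : 'cV[R]_3) : (hat w)^T = - hat w.
Proof. by apply: mx3P; split; rewrite !coordE ?oppr0 ?opprK. Qed.

(** The trace against a skew matrix only sees the skew part of [M]. This yields the rate of
    [err_A]. *)
Lemma tr_mul_hat (M : 'M[R]_3) (w : 'cV[R]_3) :
  \tr (M *m hat w) = - dot (vee (M - M^T)) w.
Proof. rewrite !coordE; ring. Qed.

(** For [N] equal to Q^T Rd G, this is how [mat_E] arises from the rate of [e_RA]. *)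
Lemma vee_mul_hat (N : 'M[R]_3) (w : 'cV[R]_3) :
  vee (N^T *m hat w + hat w *m N) = ((\tr N)%:M - N) *m w.
Proof. by apply: cV3P; rewrite !coordE; ring. Qed.

(** Multiplied by [Q^T], a cross product of two columns has determinants as entries: 1 for the third
    column, 0 by repetition for the other two. *)
Lemma SO3_cross_col (Q : 'M[R]_3) : SO3 Q ->
  [/\ cross (col o1 Q) (col o2 Q) = col o0 Q,
      cross (col o2 Q) (col o0 Q) = col o1 Q &
      cross (col o0 Q) (col o1 Q) = col o2 Q].
Proof.
move=> [QQ]; rewrite det3E => dQ.
have colij i k : col i Q k 0 = Q k i by rewrite mxE.
have E x i : Q^T *m x = delta_mx i 0 -> x = col i Q.
  by move=> e; rewrite colE -e mulmxA QQ mul1mx.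
split; apply: E; apply: cV3P; rewrite !coordE !colij !mxE ?eqxx ?eq_ord3 /= -?dQ; ring.
Qed.

(** An off-diagonal entry on the left pairs [y] with the cross product of two columns of [Q], which
    up to sign is the third column. *)
Lemma hat_rot (Q : 'M[R]_3) (y : 'cV[R]_3) : SO3 Q ->
  Q^T *m hat y *m Q = hat (Q^T *m y).
Proof.
move=> /SO3_cross_col[c0 c1 c2].
have colij i k : Q k i = col i Q k 0 by rewrite mxE.
apply: mx3P; split; rewrite !coordE; try ring.
all: rewrite ![in RHS]colij.
all: first [rewrite -c0 | rewrite -c1 | rewrite -c2].
all: rewrite !coordE -?colij; ring.
Qed.

End Coordinates.

(** * Attitude errors *)

Section AttitudeErrors.
Context {R : realType}.
Implicit Types (g : 'rV[R]_3) (Rd Q X : 'M[R]_3) (r v : 'cV[R]_3).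

Local Notation o0 := (inord 0 : 'I_3).
Local Notation o1 := (inord 1 : 'I_3).
Local Notation o2 := (inord 2 : 'I_3).

(** For orthogonal [Rd], the squared Frobenius distance from [Q] to [Rd]. *)
Definition att_dev Rd Q : R := \sum_i \sum_j (Rd^T *m Q - 1%:M) i j ^+ 2.

Lemma att_dev_ge0 Rd Q : 0 <= att_dev Rd Q.
Proof. by apply: sumr_ge0 => i _; apply: sumr_ge0 => j _; rewrite sqr_ge0. Qed.

Lemma ler_entry_att_dev Rd Q i j : (Rd^T *m Q - 1%:M) i j ^+ 2 <= att_dev Rd Q.
Proof.
rewrite /att_dev (bigD1 i)//= (bigD1 j)//= -addrA lerDl addr_ge0//.
  by apply: sumr_ge0 => k _; rewrite sqr_ge0.
by apply: sumr_ge0 => k _; apply: sumr_ge0 => l _; rewrite sqr_ge0.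
Qed.

Lemma enorm_SO3_mul Q (x : 'cV[R]_3) : SO3 Q -> enorm (Q *m x) = enorm x.
Proof.
by move=> /SO3_mulTmx QQ; rewrite !enorm_dot dot_mulmxl mulmxA QQ mul1mx.
Qed.

Lemma SO3_tr Q : SO3 Q -> SO3 Q^T.
Proof.
by move=> sQ; split; [rewrite trmxK SO3_mulTmx|rewrite det_tr; case: sQ].
Qed.

Lemma SO3_mul Q1 Q2 : SO3 Q1 -> SO3 Q2 -> SO3 (Q1 *m Q2).
Proof.
move=> [QQ1 d1] [QQ2 d2]; split; last by rewrite det_mulmx d1 d2 mulr1.
by rewrite trmx_mul mulmxA -(mulmxA Q1) QQ2 mulmx1.
Qed.

(** The 9 counts the entries, each dominated by the spectral norm. *)
Lemma att_dev_norm2 Rd Q : SO3 Rd -> att_dev Rd Q <= 9 * norm2 (Q - Rd) ^+ 2.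
Proof.
move=> sRd; have E i j : (Rd^T *m Q - 1%:M) i j ^+ 2 <= norm2 (Q - Rd) ^+ 2.
  rewrite -(SO3_mulTmx sRd) -mulmxBr -real_normK ?num_real//.
  rewrite ler_pXn2r ?nnegrE ?norm2_ge0//.
  have := ler_norm2 (Q - Rd) (delta_mx j 0); rewrite enorm_delta mulr1.
  apply: le_trans; rewrite -(enorm_SO3_mul _ (SO3_tr sRd)) mulmxA -colE.
  by have := ler_entry_enorm (col j (Rd^T *m (Q - Rd))) i; rewrite mxE.
apply: le_trans (_ : \sum_(i < 3) \sum_(j < 3) norm2 (Q - Rd) ^+ 2 <= _).
  by apply: ler_sum => i _; apply: ler_sum => j _.
by rewrite !sumr_const !card_ord -mulrnA mulr_natl.
Qed.

Lemma rRvE r v Q : rRv r v Q = dot r (Q^T *m v).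
Proof. by rewrite /rRv -mulmxA -dotE. Qed.

Lemma rRv_att_dev r v Rd Q t : SO3 Rd -> enorm r = 1 -> enorm v = 1 ->
  0 <= t -> att_dev Rd Q <= t ^+ 2 -> rRv r v Q <= rRv r v Rd + 9 * t.
Proof.
move=> sRd r1 v1 t0 dt; set Y := Rd^T *m Q - 1%:M; set y := Rd^T *m v.
have y1 : enorm y = 1 by rewrite enorm_SO3_mul//; exact: SO3_tr.
have Yt i j : `|Y i j| <= t.
  rewrite -(@ler_pXn2r _ 2) ?nnegrE// real_normK ?num_real//.
  exact: le_trans (ler_entry_att_dev _ _ _ _) dt.
have -> : rRv r v Q = rRv r v Rd + dot r (Y^T *m y).
  rewrite !rRvE -dotDr -[in RHS]/y -{1}[y]mul1mx -mulmxDl linearB /= trmx1.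
  rewrite addrCA subrr addr0 trmx_mul trmxK /y mulmxA -(mulmxA Q^T).
  by case: sRd => -> _; rewrite mulmx1.
rewrite lerD2l (le_trans (ler_dot _ _))// r1 mul1r.
apply: le_trans (ler_enorm_sum _) _.
(* The nine entries of [Y] are at most [t] in absolute value and act on a unit vector. *)
apply: le_trans (_ : \sum_(i < 3) \sum_(j < 3) t <= _).
  apply: ler_sum => i _; rewrite mxE; apply: le_trans (ler_norm_sum _ _ _) _.
  apply: ler_sum => j _; rewrite normrM trmxE -[leRHS]mulr1 ler_pM//.
  by rewrite -y1 ler_entry_enorm.
by rewrite !sumr_const !card_ord -mulrnA mulr_natl.
Qed.

(** [err_A], [e_RA] and [att_dev] depend on the attitude only through [Rd^T *m Q], so their
    estimates reduce to the identity as desired attitude. *)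
Lemma err_A_rot g Rd Q : err_A g Rd Q = err_A g 1%:M (Rd^T *m Q).
Proof. by rewrite /err_A trmx1 mul1mx. Qed.

Lemma e_RA_rot g Rd Q : e_RA g Rd Q = e_RA g 1%:M (Rd^T *m Q).
Proof. by rewrite /e_RA trmx1 !mulmx1 trmx_mul trmxK mulmxA. Qed.

Lemma att_dev_rot Rd Q : att_dev Rd Q = att_dev 1%:M (Rd^T *m Q).
Proof. by rewrite /att_dev trmx1 mul1mx. Qed.

(** * Deviation of a rotation from the identity *)

Section OrthogonalDeviation.
Variables (g : 'rV[R]_3) (X : 'M[R]_3).
Hypothesis sX : SO3 X.

Lemma err_AE : err_A g 1%:M X = 2^-1 * \sum_i g 0 i * (1 - X i i).
Proof.
by rewrite /err_A trmx1 mul1mx; congr (_ * _); rewrite sum3E !coordE; ring.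
Qed.

Lemma e_RAE : e_RA g 1%:M X = 2^-1 *: vee (diag_mx g *m X - X^T *m diag_mx g).
Proof. by rewrite /e_RA trmx1 !mulmx1. Qed.

Lemma att_devE : att_dev 1%:M X = \sum_i \sum_j (X - 1%:M) i j ^+ 2.
Proof. by rewrite /att_dev trmx1 mul1mx. Qed.

(** The rows are unit vectors. This turns [err_A], affine in the attitude, into a weighted sum of
    squares. *)
Lemma SO3_row_dev i : \sum_j (X - 1%:M) i j ^+ 2 = 2 * (1 - X i i).
Proof.
have [XX _] := sX; have := congr1 (fun M => fun_of_matrix M i i) XX.
rewrite /= mulmx3E !trmxE [X in _ = X -> _]mxE eqxx mulr1n.
by elim/ord3P: i => Xi; rewrite sum3E !coordE; lra.
Qed.

Lemma err_A_row : err_A g 1%:M X =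
  4^-1 * \sum_i g 0 i * \sum_j (X - 1%:M) i j ^+ 2.
Proof.
by rewrite err_AE sum3E [in RHS]sum3E !SO3_row_dev; lra.
Qed.

Lemma err_A_bounds m M : (forall i, m <= g 0 i <= M) ->
  m * att_dev 1%:M X <= 4 * err_A g 1%:M X <= M * att_dev 1%:M X.
Proof.
move=> hg; rewrite err_A_row mulrA divff ?mul1r ?pnatr_eq0//.
rewrite att_devE !mulr_sumr; apply/andP; split; apply: ler_sum => i _;
  have /andP[g1 g2] := hg i; rewrite ler_wpM2r//;
  by apply: sumr_ge0 => j _; rewrite sqr_ge0.
Qed.

(** 4 |e_RA|^2 is the sum over pairs of the squares of g_i X_ij - g_j X_ji. Weighted Cauchy-Schwarz
    bounds each square by g_i + g_j times the matching terms of 4 [err_A]; the pair sums are twice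
    the diagonal entries of the Hessian at the identity. *)
Lemma ler_sqr_e_RA L : (forall i, 0 < g 0 i) ->
  (forall i j, i != j -> g 0 i + g 0 j <= 2 * L) ->
  dot (e_RA g 1%:M X) (e_RA g 1%:M X) <= 2 * L * err_A g 1%:M X.
Proof.
move=> hg hL.
have pair (a b p q : R) : 0 < a -> 0 < b -> a + b <= 2 * L ->
    (a * p - b * q) ^+ 2 <= 2 * L * (a * p ^+ 2 + b * q ^+ 2).
  move=> a0 b0 ab; apply: le_trans (_ : (a + b) * (a * p ^+ 2 + b * q ^+ 2) <= _).
    rewrite -subr_ge0.
    have -> : (a + b) * (a * p ^+ 2 + b * q ^+ 2) - (a * p - b * q) ^+ 2 =
      a * b * (p + q) ^+ 2 by ring.
    by rewrite mulr_ge0 ?sqr_ge0// ltW// mulr_gt0.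
  by rewrite ler_wpM2r// addr_ge0// mulr_ge0 ?sqr_ge0 ?ltW.
have L0 : 0 < L.
  have := hL o0 o1; rewrite eq_ord3 => /(_ isT).
  by have := hg o0; have := hg o1; lra.
have dg i : 0 <= g 0 i * (X i i - 1) ^+ 2 by rewrite mulr_ge0 ?sqr_ge0 ?ltW.
have := pair (g 0 o0) (g 0 o1) (X o0 o1) (X o1 o0) (hg _) (hg _).
have := pair (g 0 o1) (g 0 o2) (X o1 o2) (X o2 o1) (hg _) (hg _).
have := pair (g 0 o2) (g 0 o0) (X o2 o0) (X o0 o2) (hg _) (hg _).
move=> /(_ (hL _ _ _)); rewrite eq_ord3 => /(_ isT) p1.
move=> /(_ (hL _ _ _)); rewrite eq_ord3 => /(_ isT) p2.
move=> /(_ (hL _ _ _)); rewrite eq_ord3 => /(_ isT) p3.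
have d0 := dg o0; have d1 := dg o1; have d2 := dg o2.
have sd : 0 <= L * (g 0 o0 * (X o0 o0 - 1) ^+ 2 + g 0 o1 * (X o1 o1 - 1) ^+ 2
  + g 0 o2 * (X o2 o2 - 1) ^+ 2) by rewrite mulr_ge0 ?addr_ge0 ?(ltW L0).
rewrite e_RAE err_A_row !sum3E !coordE; lra.
Qed.

(** With Y = X - 1, orthogonality reads Y + Y^T = - Y^T Y. Up to quadratic terms Y is skew, so g_i
    Y_ij - g_j Y_ji is close to (g_i + g_j) Y_ij and controls both entries. The diagonal of Y is
    itself quadratic in Y. *)
Lemma ger_sqr_e_RA m : 0 < m -> (forall i, m <= g 0 i) ->
  att_dev 1%:M X <= 4^-1 ->
  m ^+ 2 * att_dev 1%:M X <= 8 * dot (e_RA g 1%:M X) (e_RA g 1%:M X).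
Proof.
move=> m0 hm; set s := att_dev 1%:M X => s4.
have s0 : 0 <= s by exact: att_dev_ge0.
pose Y := X - 1%:M.
have pair (a b p q z : R) : m <= a -> m <= b -> p + q = - z -> `|z| <= s / 2 ->
    m ^+ 2 * (p ^+ 2 + q ^+ 2) <= (a * p - b * q) ^+ 2 + m ^+ 2 * s ^+ 2 / 2.
  move=> ma mb pq zs; set u := a * p - b * q.
  have z2 : z ^+ 2 <= s ^+ 2 / 4.
    rewrite -real_normK ?num_real//; have -> : s ^+ 2 / 4 = (s / 2) ^+ 2 by field.
    by rewrite ler_pXn2r ?nnegrE// divr_ge0.
  (* Solving for [p] and [q]: (a + b) p = u - b z and (a + b) q = - (u + a z). *)
  have E : (a + b) ^+ 2 * (p ^+ 2 + q ^+ 2) =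
      (u - b * z) ^+ 2 + (u + a * z) ^+ 2.
    have -> : z = - (p + q) by rewrite pq opprK.
    rewrite /u; ring.
  have ab0 : 0 < a + b by lra.
  have ab : 4 * m ^+ 2 <= (a + b) ^+ 2.
    have -> : 4 * m ^+ 2 = (m + m) ^+ 2 by ring.
    by rewrite ler_pXn2r ?nnegrE ?lerD//; lra.
  rewrite -(ler_pM2l (exprn_gt0 2 ab0)).
  have -> : (a + b) ^+ 2 * (m ^+ 2 * (p ^+ 2 + q ^+ 2)) =
    m ^+ 2 * ((u - b * z) ^+ 2 + (u + a * z) ^+ 2) by rewrite -E; ring.
  apply: le_trans (_ : m ^+ 2 * (4 * u ^+ 2 + 2 * (a + b) ^+ 2 * z ^+ 2) <= _).
    rewrite ler_wpM2l ?sqr_ge0//.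
    have := sqr_ge0 (u + b * z); have := sqr_ge0 (u - a * z).
    have : 0 <= a * b * z ^+ 2 by rewrite mulr_ge0 ?sqr_ge0// mulr_ge0//; lra.
    lra.
  rewrite mulrDr [leRHS]mulrDr lerD//.
    have := ler_wpM2r (sqr_ge0 u) ab; lra.
  have := ler_wpM2l (mulr_ge0 (sqr_ge0 m) (sqr_ge0 (a + b))) z2; lra.
have cross_dev i j : i != j -> Y i j + Y j i = - \sum_k Y k i * Y k j.
  move=> ij; have := congr1 (fun M => fun_of_matrix M i j) (SO3_mulTmx sX).
  rewrite /= mulmx3E !trmxE sum3E.
  move: i j ij; elim/ord3P; elim/ord3P; rewrite ?eqxx// => _; rewrite !coordE; lra.
have cross_bound i j : i != j -> `|\sum_k Y k i * Y k j| <= s / 2.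
  move=> ij; have cs : \sum_k Y k i ^+ 2 + \sum_k Y k j ^+ 2 <= s.
    rewrite /s att_devE exchange_big /= [leRHS](bigD1 i)//=.
    rewrite [X in _ <= _ + X](bigD1 j) 1?eq_sym//=.
    rewrite addrA lerDl; apply: sumr_ge0 => k _.
    by apply: sumr_ge0 => l _; rewrite sqr_ge0.
  have ab (x y : R) : `|x * y| <= (x ^+ 2 + y ^+ 2) / 2.
    rewrite ler_norml; have := sqr_ge0 (x + y); have := sqr_ge0 (x - y); lra.
  rewrite (le_trans (ler_norm_sum _ _ _))//.
  apply: le_trans (_ : \sum_k (Y k i ^+ 2 + Y k j ^+ 2) / 2 <= _).
    by apply: ler_sum => k _; exact: ab.
  by rewrite -mulr_suml big_split ler_wpM2r.
have diag_dev : \sum_i Y i i ^+ 2 <= s ^+ 2 / 4.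
  have E i : Y i i = - 2^-1 * \sum_j Y i j ^+ 2.
    rewrite SO3_row_dev /Y; elim/ord3P: i; rewrite !coordE; lra.
  have P i : 0 <= \sum_j Y i j ^+ 2 by apply: sumr_ge0 => j _; rewrite sqr_ge0.
  have -> : s = (\sum_j Y o0 j ^+ 2) + (\sum_j Y o1 j ^+ 2) + (\sum_j Y o2 j ^+ 2).
    by rewrite /s att_devE sum3E.
  rewrite sum3E !E.
  have := mulr_ge0 (P o0) (P o1); have := mulr_ge0 (P o1) (P o2).
  have := mulr_ge0 (P o0) (P o2); lra.
have pr i j : i != j -> m ^+ 2 * (Y i j ^+ 2 + Y j i ^+ 2) <=
    (g 0 i * Y i j - g 0 j * Y j i) ^+ 2 + m ^+ 2 * s ^+ 2 / 2.
  by move=> ij; apply: pair (cross_dev _ _ ij) _ => //; exact: cross_bound.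
have := pr o0 o1; have := pr o1 o2; have := pr o2 o0.
rewrite !eq_ord3 => /(_ isT) p1 /(_ isT) p2 /(_ isT) p3.
have dd := ler_wpM2l (sqr_ge0 m) diag_dev; rewrite sum3E in dd.
have sE : s = Y o0 o0 ^+ 2 + Y o0 o1 ^+ 2 + Y o0 o2 ^+ 2 +
    (Y o1 o0 ^+ 2 + Y o1 o1 ^+ 2 + Y o1 o2 ^+ 2) +
    (Y o2 o0 ^+ 2 + Y o2 o1 ^+ 2 + Y o2 o2 ^+ 2) by rewrite /s att_devE !sum3E.
(* The quadratic errors of the three pairs and the diagonal add up to 7/4 m^2 s^2, hence to at most
   7/16 m^2 s; they are absorbed on the left, and the factor 8 leaves some slack. *)
have s2 : m ^+ 2 * s ^+ 2 <= m ^+ 2 * s / 4.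
  by rewrite -mulrA ler_wpM2l ?sqr_ge0// expr2 ler_wpM2l.
have e2 : 4 * dot (e_RA g 1%:M X) (e_RA g 1%:M X) =
    (g 0 o0 * Y o0 o1 - g 0 o1 * Y o1 o0) ^+ 2 +
    (g 0 o1 * Y o1 o2 - g 0 o2 * Y o2 o1) ^+ 2 +
    (g 0 o2 * Y o2 o0 - g 0 o0 * Y o0 o2) ^+ 2.
  by rewrite e_RAE /Y !coordE; field.
have : m ^+ 2 * s = m ^+ 2 * (Y o0 o1 ^+ 2 + Y o1 o0 ^+ 2) +
  m ^+ 2 * (Y o1 o2 ^+ 2 + Y o2 o1 ^+ 2) +
  m ^+ 2 * (Y o2 o0 ^+ 2 + Y o0 o2 ^+ 2) +
  m ^+ 2 * (Y o0 o0 ^+ 2 + Y o1 o1 ^+ 2 + Y o2 o2 ^+ 2) by rewrite {1}sE; ring.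
have := dot_ge0 (e_RA g 1%:M X); lra.
Qed.

End OrthogonalDeviation.
End AttitudeErrors.

(** * Estimates near the desired attitude *)

Section LocalEstimates.
Context {R : realType}.

Local Notation o0 := (inord 0 : 'I_3).
Local Notation o1 := (inord 1 : 'I_3).
Local Notation o2 := (inord 2 : 'I_3).

(** Packages the choice of a small parameter: a pair [(c, d)] stands for the constraint
    [c * x < d]. *)
Lemma ex_small (s : seq (R * R)) : (forall cd, cd \in s -> 0 < cd.2) ->
  exists2 x : R, 0 < x & forall cd, cd \in s -> cd.1 * x < cd.2.
Proof.
elim: s => [_|[c d] s ih h]; first by exists 1.
have [|x x0 xs] := ih; first by move=> cd cds; apply: h; rewrite inE cds orbT.
have d0 : 0 < d by apply: (h (c, d)); rewrite mem_head.
have c0 : 0 < `|c| + 1 by rewrite ltr_wpDl.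
have y0 : 0 < Num.min x (d / (`|c| + 1)) by rewrite lt_min x0 divr_gt0.
exists (Num.min x (d / (`|c| + 1))) => // -[c' d'].
rewrite inE => /predU1P[[-> ->]|cds] /=.
  apply: le_lt_trans (_ : `|c| * Num.min x (d / (`|c| + 1)) < _).
    by rewrite ler_wpM2r ?ler_norm// ltW.
  apply: lt_le_trans (_ : (`|c| + 1) * Num.min x (d / (`|c| + 1)) <= _).
    by rewrite ltr_pM2r// ltrDl.
  by rewrite mulrC -ler_pdivlMr// ge_min lexx orbT.
have [c'0|c'0] := leP c' 0.
  apply: (@le_lt_trans _ _ (0 : R)); last by apply: (h (c', d')); rewrite inE cds orbT.
  by rewrite mulr_le0_ge0// ltW.
apply: le_lt_trans (xs _ cds); rewrite /= ler_wpM2l ?(ltW c'0)//.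
by rewrite ge_min lexx.
Qed.

Lemma dot_scale n (a : R) (x : 'cV[R]_n) : dot (a *: x) (a *: x) = a ^+ 2 * dot x x.
Proof. by rewrite dotZl dotZr mulrA. Qed.

(** Young's inequality, from |tau x - y|^2 >= 0. A small [tau] keeps the coefficient of the dominant
    term close to 1. *)
Lemma sqr_enormD_le n (x y : 'cV[R]_n) (tau : R) : 0 < tau ->
  dot (x + y) (x + y) <= (1 + tau) * dot x x + (1 + tau^-1) * dot y y.
Proof.
move=> tau0; have := dot_ge0 (tau *: x - y).
rewrite !(dotDl, dotDr, dotZl, dotZr, dotNl, dotNr) (dotC y x) => h.
have := mulr_ge0 (ltW (_ : 0 < tau^-1)) h; rewrite invr_gt0 => /(_ tau0).
rewrite -subr_ge0 => {}h; rewrite -subr_ge0; move: h; rewrite subr0.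
by congr (0 <= _); field; rewrite gt_eqF.
Qed.

(** The two sides differ by |x + 2 y|^2. *)
Lemma sqr_enorm_leD n (x y : 'cV[R]_n) :
  dot x x <= 2 * dot (x + y) (x + y) + 2 * dot y y.
Proof.
have := dot_ge0 (x + 2 *: y).
by rewrite !(dotDl, dotDr, dotZl, dotZr) (dotC y x); lra.
Qed.

Variables (r v : 'cV[R]_3) (theta alpha : R) (g : 'rV[R]_3) (Rd : 'M[R]_3).
Hypotheses (hr : enorm r = 1) (hv : enorm v = 1).
Hypotheses (htheta : 0 <= theta <= pi / 2) (halpha : 0 < alpha).
Hypotheses (hg : forall i, 0 < g 0 i) (hRd : SO3 Rd).

Lemma cos_theta_ge0 : 0 <= cos theta.
Proof.
apply: cos_ge0_pihalf; move: htheta => /andP[t0 t1].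
by rewrite t1 andbT (le_trans _ t0)// oppr_le0 divr_ge0// pi_ge0.
Qed.

Lemma rRv_geN1 Q : SO3 Q -> - 1 <= rRv r v Q.
Proof.
move=> sQ; have := ler_norm_dot r (Q^T *m v).
rewrite -rRvE enorm_SO3_mul ?hr ?hv ?mulr1; last exact: SO3_tr.
by case/ler_normlP; rewrite lerNl.
Qed.

Lemma err_B_mono Q b : b < cos theta -> rRv r v Q <= b ->
  err_B r v theta alpha Q <= 1 - alpha^-1 * ln ((cos theta - b) / (1 + cos theta)).
Proof.
move=> bc Qb; have c1 : 0 < 1 + cos theta by rewrite ltr_wpDr// cos_theta_ge0.
rewrite /err_B lerD2l lerN2 ler_pM2l ?invr_gt0// ler_ln ?posrE ?divr_gt0 ?subr_gt0//.
  by rewrite ler_pM2r ?invr_gt0// lerD2l lerN2.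
exact: le_lt_trans bc.
Qed.

(** The denominator [1 + cos theta] makes the argument of the logarithm at most 1, because [rRv] is
    at least -1. *)
Lemma err_B_ge1 Q : SO3 Q -> rRv r v Q < cos theta -> 1 <= err_B r v theta alpha Q.
Proof.
move=> sQ Qc; have c1 : 0 < 1 + cos theta by rewrite ltr_wpDr// cos_theta_ge0.
rewrite /err_B lerDl oppr_ge0 pmulr_rle0 ?invr_gt0// -ln1 ler_ln ?posrE//.
  rewrite ler_pdivrMr// mul1r; have := rRv_geN1 sQ; lra.
by rewrite divr_gt0// subr_gt0.
Qed.

Lemma ex_weight_bounds : exists m M : R, 0 < m /\ forall i, m <= g 0 i <= M.
Proof.
exists (Num.min (g 0 o0) (Num.min (g 0 o1) (g 0 o2))), (g 0 o0 + g 0 o1 + g 0 o2).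
split; first by rewrite !lt_min !hg.
have := hg o0; have := hg o1; have := hg o2 => h2 h1 h0.
by apply: ord3P; rewrite !ge_min lexx ?orbT /=; lra.
Qed.

Lemma err_A_dev m M Q : SO3 Q -> (forall i, m <= g 0 i <= M) ->
  m * att_dev Rd Q <= 4 * err_A g Rd Q <= M * att_dev Rd Q.
Proof.
move=> sQ gmM; rewrite att_dev_rot err_A_rot; apply: err_A_bounds gmM.
exact: SO3_mul (SO3_tr hRd) sQ.
Qed.

Lemma err_A_ge0 Q : SO3 Q -> 0 <= err_A g Rd Q.
Proof.
move=> sQ; have [m [M [m0 gmM]]] := ex_weight_bounds.
have /andP[+ _] := err_A_dev sQ gmM.
have : 0 <= m * att_dev Rd Q by rewrite mulr_ge0 ?att_dev_ge0 ?(ltW m0).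
lra.
Qed.

Lemma err_Psi_ge_A Q : SO3 Q -> rRv r v Q < cos theta ->
  err_A g Rd Q <= err_Psi g Rd r v theta alpha Q.
Proof.
by move=> sQ Qc; rewrite /err_Psi ler_peMr ?err_A_ge0 ?err_B_ge1.
Qed.

Variables (psi beta : R) (bA bB beA beB bE bF H : R).
Local Notation D := (dom_D g Rd r v theta alpha psi beta).
Hypotheses (hbeta : beta < cos theta) (hD : D Rd).
Hypothesis hbounds : forall Q : 'M[R]_3, D Q ->
     [/\ `|err_A g Rd Q| <= bA, `|err_B r v theta alpha Q| <= bB,
         enorm (e_RA g Rd Q) <= beA & enorm (e_RB r v theta alpha Q) <= beB] /\
     (norm2 (mat_E g Rd Q) <= bE /\ norm2 (mat_F r v theta alpha Q) <= bF).
Hypothesis hH : H = bB * bE + 2 * beA * beB + bA * bF.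

(** [Rd] lies in the domain, and there [mat_E] is diagonal with entries (g_i + g_j) / 2. *)
Lemma weights_le_bE i j : i != j -> g 0 i + g 0 j <= 2 * bE.
Proof.
have [_ [E _]] := hbounds hD; have G k := le_trans (ler_norm _)
  (le_trans (ler_entry_norm2 (mat_E g Rd Rd) k k) E).
have EE : mat_E g Rd Rd = 2^-1 *: ((\tr (diag_mx g))%:M - diag_mx g).
  by rewrite /mat_E SO3_mulTmx// mul1mx.
have := G o0; have := G o1; have := G o2; rewrite EE !coordE => h2 h1 h0.
by move: i j; elim/ord3P; elim/ord3P; rewrite ?eqxx// => _; lra.
Qed.

Lemma bE_gt0 : 0 < bE.
Proof.
have := @weights_le_bE o0 o1; rewrite eq_ord3 => /(_ isT).
have := hg o0; have := hg o1; lra.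
Qed.

Lemma H_bounds : bB * bE <= H /\ 0 < bB * bE.
Proof.
have [[A B eA eB] [_ F]] := hbounds hD.
have [_ [_ Rdb]] := hD.
have B1 := le_trans (err_B_ge1 hRd (lt_trans Rdb hbeta)) (le_trans (ler_norm _) B).
have bE0 := bE_gt0.
have A0 := le_trans (normr_ge0 _) A.
have F0 := le_trans (norm2_ge0 _) F.
have eA0 := le_trans (enorm_ge0 _) eA.
have eB0 := le_trans (enorm_ge0 _) eB.
split; last by rewrite mulr_gt0// (lt_le_trans ltr01).
by rewrite hH -addrA lerDl addr_ge0// !mulr_ge0.
Qed.

Lemma H_gt0 : 0 < H.
Proof. by have [h1 h2] := H_bounds; exact: lt_le_trans h2 h1. Qed.

Lemma err_B_bounds Q : D Q -> 1 <= err_B r v theta alpha Q <= bB.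
Proof.
move=> DQ; have [[_ B _ _] _] := hbounds DQ; have [sQ [_ Qb]] := DQ.
by rewrite (le_trans (ler_norm _) B) andbT err_B_ge1// (lt_trans Qb).
Qed.

Local Notation eR := (e_R g Rd r v theta alpha).
Local Notation Psi := (err_Psi g Rd r v theta alpha).

(* Near [Rd] the potential behaves like [err_B] times a quadratic form with
   Hessian [mat_E], so that any constant above [H] bounds [|e_R|^2 / (2 Psi)]. *)
Lemma local_estimates (H' : R) : H < H' -> exists eta C : R,
  [/\ 0 < eta, 0 < C & forall Q, SO3 Q -> err_A g Rd Q <= eta ->
    [/\ D Q, dot (eR Q) (eR Q) <= 2 * H' * Psi Q &
        err_A g Rd Q <= C * dot (eR Q) (eR Q)]].
Proof.
move=> HH'; have H0 := H_gt0.
have [m [M [m0 gmM]]] := ex_weight_bounds.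
have M0 : 0 < M by have /andP[a b] := gmM o0; exact: lt_le_trans (le_trans a b).
have gm i : m <= g 0 i by case/andP: (gmM i).
have [_ [psi0 Rdb]] := hD.
have [[_ _ _ heB] _] := hbounds hD.
have eB0 := le_trans (enorm_ge0 _) heB.
pose Bm := 1 - alpha^-1 * ln ((cos theta - beta) / (1 + cos theta)).
have Bm1 : 1 <= Bm.
  exact: le_trans (err_B_ge1 hRd (lt_trans Rdb hbeta)) (err_B_mono hbeta (ltW Rdb)).
(* The gap between 2 H and 2 H' is split in two: [tau] makes 2 (1 + tau) H use one half, and [eta]
   keeps the remainder of Young's inequality below the other. *)
pose tau := (H' - H) / (2 * H).
have tau0 : 0 < tau by rewrite divr_gt0 ?subr_gt0 ?mulr_gt0.
(* From 4 A <= M dev and m^2 dev <= 8 |e_RA|^2, with dev the value of [att_dev]. *)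
pose K := 2 * M / m ^+ 2.
have K0 : 0 < K by rewrite divr_gt0 ?mulr_gt0 ?exprn_gt0.
(* A deviation of size [t] uses at most 9 t, half of the margin of [Rd] in the constraint. *)
pose t := (beta - rRv r v Rd) / 18.
have t0 : 0 < t by rewrite divr_gt0 ?subr_gt0.
have psi_gt0 : 0 < psi.
  apply: le_lt_trans psi0.
  exact: le_trans (err_A_ge0 hRd) (err_Psi_ge_A hRd (lt_trans Rdb hbeta)).
(* In order: deviation at most 1/4, deviation at most t^2, Psi below [psi], the remainder of Young's
   inequality, and absorption of half of A in the last estimate, whence the constant [4 * K]. *)
have [|eta eta0 small] := @ex_small [:: (16, m); (4, m * t ^+ 2); (Bm, psi);
    ((1 + tau^-1) * beB ^+ 2, H' - H); (4 * K * beB ^+ 2, 1)].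
  move=> cd; rewrite !inE => /or4P[/eqP->|/eqP->|/eqP->|/orP[/eqP->|/eqP->]] //=.
    by rewrite mulr_gt0 ?exprn_gt0.
  by rewrite subr_gt0.
have s1 : 16 * eta < m by apply: (small (16, m)); rewrite !inE eqxx.
have s2 : 4 * eta < m * t ^+ 2 by apply: (small (4, m * t ^+ 2)); rewrite !inE eqxx ?orbT.
have s3 : Bm * eta < psi by apply: (small (Bm, psi)); rewrite !inE eqxx ?orbT.
have s4 : (1 + tau^-1) * beB ^+ 2 * eta < H' - H.
  by apply: (small ((1 + tau^-1) * beB ^+ 2, H' - H)); rewrite !inE eqxx ?orbT.
have s5 : 4 * K * beB ^+ 2 * eta < 1.
  by apply: (small (4 * K * beB ^+ 2, 1)); rewrite !inE eqxx ?orbT.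
exists eta, (4 * K); split=> [//||Q sQ Aeta]; first by rewrite mulr_gt0.
have A0 := err_A_ge0 sQ.
have /andP[dev1 dev2] := err_A_dev sQ gmM.
have dev0 := att_dev_ge0 Rd Q.
have devt : att_dev Rd Q <= t ^+ 2 by rewrite -(ler_pM2l m0); lra.
have dev4 : att_dev Rd Q <= 4^-1 by rewrite -(ler_pM2l m0); lra.
have Qb : rRv r v Q < beta.
  apply: le_lt_trans (rRv_att_dev hRd hr hv (ltW t0) devt) _; rewrite /t; lra.
have B1 := err_B_ge1 sQ (lt_trans Qb hbeta).
have DQ : D Q.
  split=> //; split=> //; rewrite /err_Psi; apply: le_lt_trans s3.
  by rewrite mulrC ler_pM//; [exact: le_trans B1|exact: err_B_mono (ltW Qb)].
have /andP[_ BbB] := err_B_bounds DQ.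
have [[_ _ _ eB] _] := hbounds DQ.
set ea := e_RA g Rd Q; set eb := e_RB r v theta alpha Q in eB.
set A := err_A g Rd Q in A0 Aeta dev1 dev2 *.
set B := err_B r v theta alpha Q in B1 BbB *.
have B0 : 0 < B by exact: lt_le_trans B1.
have eaA : dot ea ea <= 2 * bE * A.
  rewrite /ea /A e_RA_rot err_A_rot; apply: ler_sqr_e_RA hg weights_le_bE.
  exact: SO3_mul (SO3_tr hRd) sQ.
have eaK : A <= K * dot ea ea.
  have : m ^+ 2 * att_dev Rd Q <= 8 * dot ea ea.
    rewrite /ea e_RA_rot att_dev_rot; apply: ger_sqr_e_RA => //.
      exact: SO3_mul (SO3_tr hRd) sQ.
    by rewrite -att_dev_rot.
  move=> /(ler_wpM2l (ltW M0)) h; rewrite /K.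
  have -> : 2 * M / m ^+ 2 * dot ea ea = (2 * M * dot ea ea) / m ^+ 2.
    by rewrite mulrAC.
  rewrite ler_pdivlMr ?exprn_gt0//.
  have := ler_wpM2l (ltW (exprn_gt0 2 m0)) dev2; lra.
have ebb : dot eb eb <= beB ^+ 2.
  by rewrite -sqr_enorm ler_pXn2r ?nnegrE ?enorm_ge0.
have eRE : eR Q = B *: ea + A *: eb by [].
have PsiE : Psi Q = A * B by [].
rewrite eRE PsiE; clear eRE PsiE.
have aa0 := dot_ge0 ea; have bb0 := dot_ge0 eb.
split=> //.
- apply: le_trans (_ : (1 + tau) * B ^+ 2 * dot ea ea +
      (1 + tau^-1) * A ^+ 2 * dot eb eb <= _).
    have := sqr_enormD_le (B *: ea) (A *: eb) tau0.
    by rewrite (dot_scale B ea) (dot_scale A eb) !mulrA.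
  apply: le_trans (_ : A * B * (2 * (1 + tau) * (bB * bE)) +
      A * B * ((1 + tau^-1) * beB ^+ 2 * eta) <= _).
    rewrite lerD//.
      apply: le_trans (_ : (1 + tau) * B ^+ 2 * (2 * bE * A) <= _).
        by rewrite ler_wpM2l// mulr_ge0 ?sqr_ge0// addr_ge0// ltW.
      have bE0 := bE_gt0.
      have : 0 <= A * B * (2 * (1 + tau)) * bE.
        apply: mulr_ge0 (ltW bE0); apply: mulr_ge0;
          by rewrite mulr_ge0 ?(ltW B0)// addr_ge0// ltW.
      move=> /ler_wpM2l/(_ _ _ BbB); lra.
    have tt : 0 <= 1 + tau^-1 by rewrite addr_ge0// invr_ge0 ltW.
    apply: le_trans (_ : (1 + tau^-1) * A ^+ 2 * beB ^+ 2 <= _).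
      by rewrite ler_wpM2l// mulr_ge0 ?sqr_ge0.
    have : A <= B * eta by rewrite (le_trans Aeta)// ler_peMl// ltW.
    have : 0 <= (1 + tau^-1) * A * beB ^+ 2 by rewrite mulr_ge0 ?sqr_ge0// mulr_ge0.
    move=> /ler_wpM2l h /h; lra.
  rewrite -mulrDr [leRHS]mulrC ler_wpM2l//.
    by rewrite mulr_ge0// ltW.
  have [HbE _] := H_bounds.
  have tau1 : 0 <= 2 * (1 + tau) by rewrite mulr_ge0// addr_ge0// ltW.
  have := ler_wpM2l tau1 HbE.
  have -> : 2 * (1 + tau) * H = 2 * H + (H' - H) by rewrite /tau; field; rewrite gt_eqF.
  lra.
- have e1 : B ^+ 2 * dot ea ea <=
      2 * dot (B *: ea + A *: eb) (B *: ea + A *: eb) +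
      2 * (A ^+ 2 * dot eb eb).
    have := sqr_enorm_leD (B *: ea) (A *: eb).
    by rewrite (dot_scale B ea) (dot_scale A eb).
  set ee := dot (B *: ea + A *: eb) (B *: ea + A *: eb) in e1 *.
  have e2 : dot ea ea <= B ^+ 2 * dot ea ea.
    by rewrite ler_peMl// expr_ge1// ltW.
  have e3 : A ^+ 2 * dot eb eb <= A * (eta * beB ^+ 2).
    rewrite expr2 -mulrA ler_wpM2l// ler_pM//.
  have e4 : dot ea ea <= 2 * ee + 2 * (A * (eta * beB ^+ 2)) by lra.
  have := le_trans eaK (ler_wpM2l (ltW K0) e4).
  have := ler_wpM2l A0 (ltW s5); lra.
Qed.

Lemma ex_radius (eta : R) : 0 < eta ->
  exists2 rho : R, 0 < rho & forall Q, SO3 Q -> norm2 (Q - Rd) < rho ->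
    err_A g Rd Q < eta.
Proof.
move=> eta0; have [m [M [m0 gmM]]] := ex_weight_bounds.
have M0 : 0 < M by have /andP[a b] := gmM o0; exact: lt_le_trans (le_trans a b).
(* The second constraint, [rho < 1], lets the square of the distance be bounded by [rho], so that
   the first one can be linear. *)
have [|rho rho0 small] := @ex_small [:: (9 * M, 4 * eta); (1, 1)].
  move=> cd; rewrite !inE => /orP[/eqP->|/eqP->] //=; lra.
have s1 : 9 * M * rho < 4 * eta by apply: (small (9 * M, 4 * eta)); rewrite !inE eqxx.
have s2 : 1 * rho < 1 by apply: (small (1, 1)); rewrite !inE eqxx orbT.
exists rho => // Q sQ Qrho.
have /andP[_ dev2] := err_A_dev sQ gmM.
have := att_dev_norm2 Q hRd; set n := norm2 _ in Qrho * => devn.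
have n0 : 0 <= n by exact: norm2_ge0.
have nn : n ^+ 2 <= rho by rewrite expr2 -[leRHS]mulr1 ler_pM//; lra.
have := ler_wpM2l (ltW M0) devn.
have := ler_wpM2l (ltW M0) nn; lra.
Qed.

End LocalEstimates.

(** * Derivatives and limits along trajectories *)

Section EntrywiseCalculus.
Context {R : realType}.

(** Here and below the rules are restated for pointwise [fun s => _] expressions, the shape in which
    the error variables unfold. *)
Lemma is_deriveD_fun (f g : R -> R) (t df dg : R) :
  is_derive t 1 f df -> is_derive t 1 g dg ->
  is_derive t 1 (fun s => f s + g s) (df + dg).
Proof. by move=> hf hg; exact: is_deriveD. Qed.

Lemma is_deriveM_fun (f g : R -> R) (t df dg : R) :
  is_derive t 1 f df -> is_derive t 1 g dg ->
  is_derive t 1 (fun s => f s * g s) (df * g t + f t * dg).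
Proof.
move=> hf hg; have -> : df * g t + f t * dg = f t *: dg + g t *: df.
  by rewrite addrC [df * _]mulrC.
exact: is_deriveM.
Qed.

Lemma is_derive_sum_fun n (f : 'I_n -> R -> R) (t : R) (df : 'I_n -> R) :
  (forall i, is_derive t 1 (f i) (df i)) ->
  is_derive t 1 (fun s => \sum_i f i s) (\sum_i df i).
Proof.
move=> hf; have -> : (fun s => \sum_i f i s) = \sum_i f i.
  by apply/funext => s; rewrite fct_sumE.
exact: is_derive_sum.
Qed.

Lemma is_derive_cst_fun (a t : R) : is_derive t 1 (fun=> a) 0.
Proof. exact: is_derive_cst. Qed.

Lemma is_deriveN_fun (f : R -> R) (t df : R) : is_derive t 1 f df ->
  is_derive t 1 (fun s => - f s) (- df).
Proof. by move=> hf; exact: is_deriveN. Qed.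

Lemma is_derive_ln_fun (f : R -> R) (t df : R) : 0 < f t -> is_derive t 1 f df ->
  is_derive t 1 (fun s => ln (f s)) (df / f t).
Proof.
move=> ft hf; rewrite mulrC.
by apply: (@is_derive1_comp _ (@ln R) f) => //; exact: is_derive1_ln.
Qed.

Lemma is_deriveV_fun (f : R -> R) (t df : R) : f t != 0 -> is_derive t 1 f df ->
  is_derive t 1 (fun s => (f s)^-1) (- df / f t ^+ 2).
Proof.
move=> ft hf; have -> : - df / f t ^+ 2 = - (f t) ^- 2 *: df.
  by rewrite mulNr mulrC -mulNr.
exact: is_deriveV.
Qed.

Lemma mx_derive_cst m n (A : 'M[R]_(m, n)) (t : R) : mx_derive (fun=> A) t 0.
Proof. by move=> i j; rewrite mxE; exact: is_derive_cst_fun. Qed.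

Lemma mx_deriveD m n (X Y : R -> 'M[R]_(m, n)) (t : R) dX dY :
  mx_derive X t dX -> mx_derive Y t dY ->
  mx_derive (fun s => X s + Y s) t (dX + dY).
Proof.
move=> hX hY i j; rewrite mxE.
have -> : (fun s => (X s + Y s) i j) = (fun s => X s i j + Y s i j).
  by apply/funext => s; rewrite mxE.
exact: is_deriveD_fun.
Qed.

Lemma mx_deriveM m n p (X : R -> 'M[R]_(m, n)) (Y : R -> 'M[R]_(n, p)) (t : R) dX dY :
  mx_derive X t dX -> mx_derive Y t dY ->
  mx_derive (fun s => X s *m Y s) t (dX *m Y t + X t *m dY).
Proof.
move=> hX hY i j.
have -> : (fun s => (X s *m Y s) i j) = (fun s => \sum_k X s i k * Y s k j).
  by apply/funext => s; rewrite mxE.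
have -> : (dX *m Y t + X t *m dY) i j =
    \sum_k (dX i k * Y t k j + X t i k * dY k j).
  by rewrite !mxE -big_split.
by apply: is_derive_sum_fun => k; exact: is_deriveM_fun.
Qed.

Lemma mx_derive_tr m n (X : R -> 'M[R]_(m, n)) (t : R) dX :
  mx_derive X t dX -> mx_derive (fun s => (X s)^T) t dX^T.
Proof.
move=> hX i j; rewrite mxE.
have -> : (fun s => (X s)^T i j) = (fun s => X s j i).
  by apply/funext => s; rewrite mxE.
exact: hX.
Qed.

Lemma mx_deriveZ m n (a : R -> R) (X : R -> 'M[R]_(m, n)) (t : R) da dX :
  is_derive t 1 a da -> mx_derive X t dX ->
  mx_derive (fun s => a s *: X s) t (da *: X t + a t *: dX).
Proof.
move=> ha hX i j; rewrite !mxE.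
have -> : (fun s => (a s *: X s) i j) = (fun s => a s * X s i j).
  by apply/funext => s; rewrite mxE.
exact: is_deriveM_fun.
Qed.

Lemma mx_deriveN m n (X : R -> 'M[R]_(m, n)) (t : R) dX :
  mx_derive X t dX -> mx_derive (fun s => - X s) t (- dX).
Proof.
move=> hX i j; rewrite mxE.
have -> : (fun s => (- X s) i j) = (fun s => - X s i j).
  by apply/funext => s; rewrite mxE.
exact: is_deriveN_fun.
Qed.

Lemma mx_derive_mull m n p (A : 'M[R]_(m, n)) (X : R -> 'M[R]_(n, p)) (t : R) dX :
  mx_derive X t dX -> mx_derive (fun s => A *m X s) t (A *m dX).
Proof.
by move=> hX; have := mx_deriveM (mx_derive_cst A t) hX; rewrite mul0mx add0r.
Qed.

Lemma mx_derive_mulr m n p (X : R -> 'M[R]_(m, n)) (A : 'M[R]_(n, p)) (t : R) dX :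
  mx_derive X t dX -> mx_derive (fun s => X s *m A) t (dX *m A).
Proof.
by move=> hX; have := mx_deriveM hX (mx_derive_cst A t); rewrite mulmx0 addr0.
Qed.

Lemma is_derive_trace n (X : R -> 'M[R]_n) (t : R) dX :
  mx_derive X t dX -> is_derive t 1 (fun s => \tr (X s)) (\tr dX).
Proof. by move=> hX; apply: is_derive_sum_fun => i; exact: hX. Qed.

Lemma is_derive_dot n (x y : R -> 'cV[R]_n) (t : R) dx dy :
  mx_derive x t dx -> mx_derive y t dy ->
  is_derive t 1 (fun s => dot (x s) (y s)) (dot dx (y t) + dot (x t) dy).
Proof.
move=> hx hy; rewrite /dot -big_split.
by apply: is_derive_sum_fun => i; apply: is_deriveM_fun; [exact: hx|exact: hy].
Qed.

Lemma mx_derive_vee (X : R -> 'M[R]_3) (t : R) dX :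
  mx_derive X t dX -> mx_derive (fun s => vee (X s)) t (vee dX).
Proof.
move=> hX i j; rewrite ord1; elim/ord3P: i; rewrite !veeE;
under eq_fun do rewrite veeE; exact: hX.
Qed.

End EntrywiseCalculus.

(** * Rates of the attitude errors *)

Section ErrorKinematics.
Context {R : realType}.
Variables (r v : 'cV[R]_3) (theta alpha : R) (g : 'rV[R]_3) (Rd : 'M[R]_3).

(** Product rule for [e_R], with rates e_RB . w for B, E w for e_RA, e_RA . w for A and F w for
    e_RB. The two mixed summands account for the term [2 * beA * beB] of [H]. *)
Definition e_R_rate (Q : 'M[R]_3) (w : 'cV[R]_3) : 'cV[R]_3 :=
  dot (e_RB r v theta alpha Q) w *: e_RA g Rd Q +
  err_B r v theta alpha Q *: (mat_E g Rd Q *m w) +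
  (dot (e_RA g Rd Q) w *: e_RB r v theta alpha Q +
   err_A g Rd Q *: (mat_F r v theta alpha Q *m w)).

Hypothesis halpha : 0 < alpha.
Variables (Q : R -> 'M[R]_3) (w : 'cV[R]_3) (t : R).
Hypothesis dQ : mx_derive Q t (Q t *m hat w).

Lemma err_A_derive :
  is_derive t 1 (fun s => err_A g Rd (Q s)) (dot (e_RA g Rd (Q t)) w).
Proof.
(* The rate is put in the exact shape produced by the product rule, null derivatives of constants
   included. *)
have -> : dot (e_RA g Rd (Q t)) w =
    0 * \tr (diag_mx g *m (1%:M - Rd^T *m Q t)) +
    2^-1 * \tr (diag_mx g *m (0 - Rd^T *m (Q t *m hat w))).
  rewrite mul0r add0r sub0r mulmxN !mulmxA linearN /= tr_mul_hat opprK.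
  by rewrite /e_RA dotZl !trmx_mul trmxK tr_diag_mx mulmxA.
apply: is_deriveM_fun.
apply: is_derive_trace; apply: mx_derive_mull; apply: mx_deriveD.
  exact: mx_derive_cst.
by apply: mx_deriveN; exact: mx_derive_mull.
Qed.

Lemma trQv_derive : mx_derive (fun s => (Q s)^T *m v) t (- (hat w *m ((Q t)^T *m v))).
Proof.
rewrite mulmxA -mulNmx; apply: mx_derive_mulr.
by rewrite -mulNmx -hat_tr -trmx_mul; exact: mx_derive_tr.
Qed.

Lemma rRv_derive :
  is_derive t 1 (fun s => rRv r v (Q s)) (dot (hat r *m ((Q t)^T *m v)) w).
Proof.
have -> : dot (hat r *m ((Q t)^T *m v)) w =
    dot (0 : 'cV[R]_3) ((Q t)^T *m v) + dot r (- (hat w *m ((Q t)^T *m v))).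
  rewrite dot0l add0r; move: (_ *m v) => y.
  rewrite !coordE; ring.
under eq_fun do rewrite rRvE.
apply: is_derive_dot trQv_derive; exact: mx_derive_cst.
Qed.

Hypothesis Qadm : rRv r v (Q t) < cos theta.
Hypothesis htheta : 0 <= cos theta.

Lemma err_B_derive :
  is_derive t 1 (fun s => err_B r v theta alpha (Q s))
    (dot (e_RB r v theta alpha (Q t)) w).
Proof.
have c1 : 0 < 1 + cos theta by rewrite ltr_wpDr.
have f0 : 0 < (cos theta - rRv r v (Q t)) / (1 + cos theta).
  by rewrite divr_gt0// subr_gt0.
pose ds := dot (hat r *m ((Q t)^T *m v)) w.
have -> : dot (e_RB r v theta alpha (Q t)) w =
  0 + - (0 * ln ((cos theta - rRv r v (Q t)) / (1 + cos theta)) +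
    alpha^-1 * ((((0 + - ds) * (1 + cos theta)^-1 +
      (cos theta - rRv r v (Q t)) * 0)) /
      ((cos theta - rRv r v (Q t)) / (1 + cos theta)))).
  have -> : ds = - dot (hat ((Q t)^T *m v) *m r) w.
    rewrite /ds; move: (_ *m v) => y; rewrite !coordE; ring.
  rewrite /e_RB dotZl; move: (dot _ w) => d; field.
  by rewrite !subr_eq0 [cos theta == _]gt_eqF// [_ == cos theta]lt_eqF// !gt_eqF.
apply: is_deriveD_fun.
apply: is_deriveN_fun; apply: is_deriveM_fun.
apply: is_derive_ln_fun => //; apply: is_deriveM_fun.
apply: is_deriveD_fun.
by apply: is_deriveN_fun; exact: rRv_derive.
Qed.

Lemma e_RA_derive :
  mx_derive (fun s => e_RA g Rd (Q s)) t (mat_E g Rd (Q t) *m w).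
Proof.
pose N := (Q t)^T *m Rd *m diag_mx g.
have -> : mat_E g Rd (Q t) *m w =
    0 *: vee (diag_mx g *m Rd^T *m Q t - (Q t)^T *m Rd *m diag_mx g) +
    2^-1 *: vee (diag_mx g *m Rd^T *m (Q t *m hat w) -
                 (Q t *m hat w)^T *m Rd *m diag_mx g).
  rewrite scale0r add0r /mat_E -scalemxAl; congr (_ *: _).
  rewrite -vee_mul_hat; congr vee.
  by rewrite !trmx_mul hat_tr !trmxK tr_diag_mx !mulNmx opprK !mulmxA.
apply: mx_deriveZ.
apply: mx_derive_vee; apply: mx_deriveD; first exact: mx_derive_mull.
apply: mx_deriveN; do 2!apply: mx_derive_mulr; exact: mx_derive_tr.
Qed.

Hypothesis sQ : SO3 (Q t).

(** Orthogonality enters the kinematics here: [mat_F] contains [Q^T *m hat v *m Q], which [hat_rot]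
    turns into a function of [Q^T *m v]. *)
Lemma e_RB_derive :
  mx_derive (fun s => e_RB r v theta alpha (Q s)) t
    (mat_F r v theta alpha (Q t) *m w).
Proof.
pose y := (Q t)^T *m v; pose s := rRv r v (Q t).
have sc0 : alpha * (s - cos theta) != 0.
  by rewrite mulf_neq0 ?subr_eq0 ?[s == _]lt_eqF// gt_eqF.
pose ds := dot (hat r *m y) w.
have -> : mat_F r v theta alpha (Q t) *m w =
    (- (0 * (s - cos theta) + alpha * (ds + 0)) /
       (alpha * (s - cos theta)) ^+ 2) *: (hat y *m r)
    + (alpha * (s - cos theta))^-1 *: (- (hat r *m - (hat w *m y))).
  rewrite /mat_F -/s.
  have -> : (v^T *m Q t *m r) 0 0 = dot y r.
    by rewrite dotE /y trmx_mul trmxK.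
  have -> : (Q t)^T *m hat v *m Q t = hat y by exact: hat_rot.
  have -> : v^T *m Q t = y^T by rewrite /y trmx_mul trmxK.
  (* The identity does not depend on [s] being r . y, so both are generalised and a rational
     identity in coordinates remains. *)
  rewrite -/y /ds; clear ds; move: y s sc0 => y s sc0.
  have [a0 s0] : alpha != 0 /\ s - cos theta != 0.
    by apply/andP; rewrite -negb_or -mulf_eq0.
  by apply: cV3P; rewrite !coordE; field; rewrite a0 s0.
have -> : (fun s => e_RB r v theta alpha (Q s)) =
    (fun s => (alpha * (rRv r v (Q s) - cos theta))^-1 *: - (hat r *m ((Q s)^T *m v))).
  apply/funext => u; rewrite /e_RB; congr (_ *: _); move: (_ *m v) => z.
  by apply: cV3P; rewrite !coordE; ring.
have -> : hat y *m r = - (hat r *m ((Q t)^T *m v)).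
  by rewrite -/y; apply: cV3P; rewrite !coordE; ring.
apply: mx_deriveZ.
  apply: is_deriveV_fun => //; apply: is_deriveM_fun.
  by apply: is_deriveD_fun; exact: rRv_derive.
by apply: mx_deriveN; apply: mx_derive_mull; exact: trQv_derive.
Qed.

Lemma e_R_derive : mx_derive (fun s => e_R g Rd r v theta alpha (Q s)) t
  (e_R_rate (Q t) w).
Proof.
apply: mx_deriveD; apply: mx_deriveZ.
- exact: err_B_derive.
- exact: e_RA_derive.
- exact: err_A_derive.
- exact: e_RB_derive.
Qed.

Lemma err_Psi_derive : is_derive t 1
  (fun s => err_Psi g Rd r v theta alpha (Q s))
  (dot (e_R g Rd r v theta alpha (Q t)) w).
Proof.
have -> : dot (e_R g Rd r v theta alpha (Q t)) w =
    dot (e_RA g Rd (Q t)) w * err_B r v theta alpha (Q t) +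
    err_A g Rd (Q t) * dot (e_RB r v theta alpha (Q t)) w.
  by rewrite /e_R dotDl !(dotZl (err_A _ _ _), dotZl (err_B _ _ _ _ _)) mulrC.
by apply: is_deriveM_fun; [exact: err_A_derive|exact: err_B_derive].
Qed.

End ErrorKinematics.

(** * Limits of the attitude errors along a filter *)

Section EntrywiseLimits.
Context {R : realType} {T : Type} (F : set_system T) {FF : Filter F}.

(** Entrywise like [solves_on], and for any filter, so as to cover neighbourhoods within a segment,
    in particular at time 0. *)
Definition mx_cvg m n (X : T -> 'M[R]_(m, n)) (L : 'M[R]_(m, n)) : Prop :=
  forall i j, X s i j @[s --> F] --> L i j.

Lemma mx_cvg_cst m n (A : 'M[R]_(m, n)) : mx_cvg (fun=> A) A.
Proof. by move=> i j; exact: cvg_cst. Qed.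

Lemma mx_cvgD m n (X Y : T -> 'M[R]_(m, n)) A B :
  mx_cvg X A -> mx_cvg Y B -> mx_cvg (fun s => X s + Y s) (A + B).
Proof.
move=> hX hY i j; rewrite mxE; under eq_fun do rewrite mxE.
by apply: cvgD; [exact: hX|exact: hY].
Qed.

Lemma mx_cvgN m n (X : T -> 'M[R]_(m, n)) A :
  mx_cvg X A -> mx_cvg (fun s => - X s) (- A).
Proof.
by move=> hX i j; rewrite mxE; under eq_fun do rewrite mxE; apply: cvgN; exact: hX.
Qed.

Lemma mx_cvgM m n p (X : T -> 'M[R]_(m, n)) (Y : T -> 'M[R]_(n, p)) A B :
  mx_cvg X A -> mx_cvg Y B -> mx_cvg (fun s => X s *m Y s) (A *m B).
Proof.
move=> hX hY i j; rewrite mxE; under eq_fun do rewrite mxE.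
by apply: cvg_sumr => k; apply: cvgM; [exact: hX|exact: hY].
Qed.

Lemma mx_cvg_tr m n (X : T -> 'M[R]_(m, n)) A :
  mx_cvg X A -> mx_cvg (fun s => (X s)^T) A^T.
Proof. by move=> hX i j; rewrite mxE; under eq_fun do rewrite mxE; exact: hX. Qed.

Lemma mx_cvgZ m n (a : T -> R) (X : T -> 'M[R]_(m, n)) (b : R) A :
  a s @[s --> F] --> b -> mx_cvg X A -> mx_cvg (fun s => a s *: X s) (b *: A).
Proof.
by move=> ha hX i j; rewrite mxE; under eq_fun do rewrite mxE; apply: cvgM ha (hX i j).
Qed.

Lemma cvg_trace n (X : T -> 'M[R]_n) A :
  mx_cvg X A -> \tr (X s) @[s --> F] --> \tr A.
Proof. by move=> hX; apply: cvg_sumr => i; exact: hX. Qed.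

Lemma cvg_dot n (x y : T -> 'cV[R]_n) a b :
  mx_cvg x a -> mx_cvg y b -> dot (x s) (y s) @[s --> F] --> dot a b.
Proof.
by move=> hx hy; apply: cvg_sumr => i; apply: cvgM; [exact: hx|exact: hy].
Qed.

Lemma mx_cvg_vee (X : T -> 'M[R]_3) A :
  mx_cvg X A -> mx_cvg (fun s => vee (X s)) (vee A).
Proof.
move=> hX i j; rewrite ord1; elim/ord3P: i; rewrite !veeE;
under eq_fun do rewrite veeE; exact: hX.
Qed.

Lemma mx_cvg_hat (x : T -> 'cV[R]_3) a :
  mx_cvg x a -> mx_cvg (fun s => hat (x s)) (hat a).
Proof.
move=> hx i j; elim/ord3P: i; elim/ord3P: j; rewrite !hatE;
under eq_fun do rewrite hatE; first [exact: hx|apply: cvgN; exact: hx|exact: cvg_cst].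
Qed.

Variables (r v : 'cV[R]_3) (theta alpha : R) (g : 'rV[R]_3) (Rd : 'M[R]_3).
Variables (Q : T -> 'M[R]_3) (Q0 : 'M[R]_3).
Hypothesis hQ : mx_cvg Q Q0.

Lemma cvg_err_A : err_A g Rd (Q s) @[s --> F] --> err_A g Rd Q0.
Proof.
apply: cvgM; first exact: cvg_cst.
apply: cvg_trace; apply: mx_cvgM; first exact: mx_cvg_cst.
apply: mx_cvgD; first exact: mx_cvg_cst.
by apply: mx_cvgN; apply: mx_cvgM => //; exact: mx_cvg_cst.
Qed.

Lemma cvg_rRv : rRv r v (Q s) @[s --> F] --> rRv r v Q0.
Proof.
rewrite rRvE; under eq_fun do rewrite rRvE.
apply: cvg_dot; first exact: mx_cvg_cst.
by apply: mx_cvgM; [exact: mx_cvg_tr|exact: mx_cvg_cst].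
Qed.

Hypotheses (halpha : 0 < alpha) (htheta : 0 <= cos theta).
Hypothesis Qadm : rRv r v Q0 < cos theta.

Lemma cvg_err_B : err_B r v theta alpha (Q s) @[s --> F] --> err_B r v theta alpha Q0.
Proof.
apply: cvgB; first exact: cvg_cst.
apply: cvgM; first exact: cvg_cst.
apply: (@cvg_comp _ _ _ (fun s => (cos theta - rRv r v (Q s)) / (1 + cos theta)) (@ln R)
  F _ _ _ (continuous_ln _)).
  apply: cvgM; last exact: cvg_cst.
  by apply: cvgB; [exact: cvg_cst|exact: cvg_rRv].
by rewrite divr_gt0 ?subr_gt0// ltr_wpDr.
Qed.

Lemma mx_cvg_e_RA : mx_cvg (fun s => e_RA g Rd (Q s)) (e_RA g Rd Q0).
Proof.
apply: mx_cvgZ; first exact: cvg_cst.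
apply: mx_cvg_vee; apply: mx_cvgD.
  by apply: mx_cvgM => //; exact: mx_cvg_cst.
apply: mx_cvgN; apply: mx_cvgM; last exact: mx_cvg_cst.
by apply: mx_cvgM; [exact: mx_cvg_tr|exact: mx_cvg_cst].
Qed.

Lemma mx_cvg_e_RB :
  mx_cvg (fun s => e_RB r v theta alpha (Q s)) (e_RB r v theta alpha Q0).
Proof.
apply: mx_cvgZ.
  apply: cvgV; first by rewrite mulf_neq0 ?subr_eq0 ?[rRv _ _ _ == _]lt_eqF// gt_eqF.
  apply: cvgM; first exact: cvg_cst.
  by apply: cvgB; [exact: cvg_rRv|exact: cvg_cst].
apply: mx_cvgM; last exact: mx_cvg_cst.
by apply: mx_cvg_hat; apply: mx_cvgM; [exact: mx_cvg_tr|exact: mx_cvg_cst].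
Qed.

Lemma mx_cvg_e_R :
  mx_cvg (fun s => e_R g Rd r v theta alpha (Q s)) (e_R g Rd r v theta alpha Q0).
Proof.
apply: mx_cvgD; apply: mx_cvgZ.
- exact: cvg_err_B.
- exact: mx_cvg_e_RA.
- exact: cvg_err_A.
- exact: mx_cvg_e_RB.
Qed.

Lemma cvg_err_Psi : err_Psi g Rd r v theta alpha (Q s) @[s --> F] -->
  err_Psi g Rd r v theta alpha Q0.
Proof. by apply: cvgM; [exact: cvg_err_A|exact: cvg_err_B]. Qed.

End EntrywiseLimits.

(** * Lyapunov function *)

Section ClosedLoopStability.
Context {R : realType}.
Variables (p : nat) (J : 'M[R]_3) (lambdaM : R).
Variables (W : 'M[R]_3 -> 'cV[R]_3 -> 'M[R]_(3, p)) (Delta : 'cV[R]_p) (BW : R).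
Hypotheses (hJ : pos_def J) (hlambdaM : max_eigenvalue J lambdaM).
Hypothesis hW : forall (Q : 'M[R]_3) (w : 'cV[R]_3), SO3 Q -> norm2 (W Q w) <= BW.
Variables (r v : 'cV[R]_3) (theta alpha : R) (g : 'rV[R]_3) (Rd : 'M[R]_3).
Hypotheses (hr : enorm r = 1) (hv : enorm v = 1).
Hypotheses (htheta : 0 <= theta <= pi / 2) (halpha : 0 < alpha).
Hypotheses (hg : forall i, 0 < g 0 i) (hRd : SO3 Rd).
Variables (psi beta : R) (bA bB beA beB bE bF H : R).
Local Notation D := (dom_D g Rd r v theta alpha psi beta).
Hypotheses (hbeta : beta < cos theta) (hD : D Rd).
Hypothesis hbounds : forall Q : 'M[R]_3, D Q ->
     [/\ `|err_A g Rd Q| <= bA, `|err_B r v theta alpha Q| <= bB,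
         enorm (e_RA g Rd Q) <= beA & enorm (e_RB r v theta alpha Q) <= beB] /\
     (norm2 (mat_E g Rd Q) <= bE /\ norm2 (mat_F r v theta alpha Q) <= bF).
Hypothesis hH : H = bB * bE + 2 * beA * beB + bA * bF.
Variables (kR kOmega kDelta c : R).
Hypotheses (hkR : 0 < kR) (hkOmega : 0 < kOmega) (hkDelta : 0 < kDelta).
Hypotheses (hc0 : 0 < c)
  (hc : c < 4 * kR * kOmega / (kOmega ^+ 2 + 4 * kR * lambdaM * H)).

Local Notation eR := (e_R g Rd r v theta alpha).
Local Notation Psi := (err_Psi g Rd r v theta alpha).
Local Notation sys := (closed_loop g Rd r v theta alpha J W Delta kR kOmega kDelta c).
Local Notation err := (error_vector g Rd r v theta alpha Delta).

Let cos0 : 0 <= cos theta := cos_theta_ge0 htheta.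
Let l0 : 0 < lambdaM := max_eigenvalue_gt0 hJ hlambdaM.
Let H0 : 0 < H.
Proof. exact: (H_gt0 hr hv htheta halpha hg hRd hbeta hD hbounds hH). Qed.

Lemma enorm_e_R_rate Q w : D Q ->
  enorm (e_R_rate r v theta alpha g Rd Q w) <= H * enorm w.
Proof.
move=> DQ; have [[A B eA eB] [E F]] := hbounds DQ.
have w0 := enorm_ge0 w.
have N (a b : R) (M : 'M[R]_3) bM : `|a| <= b -> norm2 M <= bM ->
    enorm (a *: (M *m w)) <= b * bM * enorm w.
  move=> ab MM; rewrite enormZ -mulrA ler_pM ?enorm_ge0//.
  by apply: le_trans (ler_norm2 _ _) _; rewrite ler_wpM2r.
have P (x y : 'cV[R]_3) bx by' : enorm x <= bx -> enorm y <= by' ->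
    enorm (dot x w *: y) <= bx * by' * enorm w.
  move=> xb yb; rewrite enormZ mulrAC ler_pM ?enorm_ge0//.
  by apply: le_trans (ler_norm_dot _ _) _; rewrite ler_wpM2r.
rewrite /e_R_rate; apply: le_trans (ler_enormD _ _) _.
apply: le_trans (lerD (ler_enormD _ _) (ler_enormD _ _)) _.
have := P _ _ _ _ eB eA; have := P _ _ _ _ eA eB.
have := N _ _ _ _ B E; have := N _ _ _ _ A F.
rewrite hH; lra.
Qed.

(** * Consequences of the bound on the gain *)

Lemma gain_gap : c * (kOmega ^+ 2 + 4 * kR * lambdaM * H) < 4 * kR * kOmega.
Proof.
by rewrite -ltr_pdivlMr// addr_gt0 ?exprn_gt0// !mulr_gt0.
Qed.

(** [gain_gap] times c gives 4 c^2 kR lambdaM H < c kOmega (4 kR - c kOmega), and the right side is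
    at most 4 kR^2. *)
Lemma gain_sqr : c ^+ 2 * lambdaM * H < kR.
Proof.
have := sqr_ge0 (c * kOmega - 2 * kR).
have : 0 < c * (4 * kR * kOmega - c * (kOmega ^+ 2 + 4 * kR * lambdaM * H)).
  by rewrite mulr_gt0// subr_gt0 gain_gap.
move=> h1 h2; have : 0 < 4 * kR * (kR - c ^+ 2 * lambdaM * H) by lra.
by rewrite pmulr_rgt0 ?mulr_gt0// subr_gt0.
Qed.

Lemma ex_decay_rate : exists2 k : R, 0 < k & forall x y : R,
  - (kOmega - c * lambdaM * H) * x ^+ 2 + c * kOmega * (x * y) - c * kR * y ^+ 2
    <= - k * (x ^+ 2 + y ^+ 2).
Proof.
pose a := kOmega - c * lambdaM * H; pose d := c * kR; pose b := c * kOmega.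
have disc : b ^+ 2 < 4 * a * d.
  have := gain_gap; rewrite -(ltr_pM2l hc0) /a /b /d; lra.
have d0 : 0 < d by rewrite mulr_gt0.
have a0 : 0 < a.
  have : 0 < 4 * a * d by exact: le_lt_trans (sqr_ge0 _) disc.
  by rewrite pmulr_lgt0// pmulr_rgt0.
have ad0 : 0 < 4 * (a + d) by rewrite mulr_gt0// addr_gt0.
(* Determinant over trace of the form a x^2 - b x y + d y^2, a lower bound for its smaller
   eigenvalue: 4 (a - k) (d - k) equals b^2 + 4 k^2. *)
pose k := (4 * a * d - b ^+ 2) / (4 * (a + d)).
exists k; first by rewrite divr_gt0// subr_gt0.
move=> x y; rewrite -/a -/d -/b.
have kE : k * (4 * (a + d)) = 4 * a * d - b ^+ 2 by rewrite divfK// gt_eqF.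
have kd : k < d.
  rewrite ltr_pdivrMr//; have := sqr_ge0 b; have := exprn_gt0 2 d0; lra.
have ak : b ^+ 2 <= 4 * (a - k) * (d - k) by have := sqr_ge0 k; lra.
have h := sqr_ge0 (2 * (d - k) * y - b * x).
have h' := ler_wpM2r (sqr_ge0 x) ak.
have : 0 <= 4 * (d - k) * ((a - k) * x ^+ 2 - b * (x * y) + (d - k) * y ^+ 2) by lra.
rewrite pmulr_rge0 ?mulr_gt0 ?subr_gt0//; lra.
Qed.

Definition lyapunov (Q : 'M[R]_3) (w : 'cV[R]_3) (Db : 'cV[R]_p) : R :=
  2^-1 * dot w (J *m w) + kR * Psi Q + c * dot (J *m w) (eR Q) +
  (2 * kDelta)^-1 * dot (Delta - Db) (Delta - Db).

Lemma control_momentum Q w Db a :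
  J *m a + cross w (J *m w) =
    control g Rd r v theta alpha J W kR kOmega Q w Db + W Q w *m Delta ->
  J *m a = - (kR *: eR Q) - kOmega *: w + W Q w *m (Delta - Db).
Proof.
move=> E; apply: (addIr (cross w (J *m w))); rewrite E /control mulmxBr.
by rewrite [in RHS]addrAC -!addrA; congr (_ + (_ + (_ + _))); rewrite addrC.
Qed.

(** * The Lyapunov function along a trajectory *)

Section Trajectory.
Variables (T : \bar R) (Q : R -> 'M[R]_3) (w : R -> 'cV[R]_3) (Db : R -> 'cV[R]_p).
Hypothesis hsys : sys T Q w Db.

Let V t := lyapunov (Q t) (w t) (Db t).
Let f t := enorm (w t) ^+ 2 + enorm (eR (Q t)) ^+ 2.

Lemma lyapunov_derive k :
  (forall x y : R,
    - (kOmega - c * lambdaM * H) * x ^+ 2 + c * kOmega * (x * y) - c * kR * y ^+ 2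
    <= - k * (x ^+ 2 + y ^+ 2)) ->
  forall t, 0 < t -> (t%:E < T)%E -> D (Q t) ->
  exists2 dV, is_derive t 1 V dV & dV <= - k * f t.
Proof.
move=> hk t t0 tT DQ.
have [adm [_ dQ] [dw [_ dwE] Jdw] [_ dDb]] := hsys.
have [sQ Qadm] : SO3 (Q t) /\ rRv r v (Q t) < cos theta.
  by apply: adm; split; rewrite ?ltW.
have {}dQ := dQ t t0 tT; have {}dwE := dwE t t0 tT; have {}dDb := dDb t t0 tT.
have {}Jdw := Jdw t t0 tT; rewrite /= in dQ dDb.
set u := update_law _ _ _ _ _ _ _ _ _ _ _ in dDb.
have dJw := mx_derive_mull J dwE.
set e := eR (Q t); set de := e_R_rate r v theta alpha g Rd (Q t) (w t).
pose eD := Delta - Db t.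
exists (0 * dot (w t) (J *m w t) +
    2^-1 * (dot (dw t) (J *m w t) + dot (w t) (J *m dw t)) +
  (0 * Psi (Q t) + kR * dot e (w t)) +
  (0 * dot (J *m w t) e + c * (dot (J *m dw t) e + dot (J *m w t) de)) +
  (0 * dot eD eD + (2 * kDelta)^-1 * (dot (0 - u) eD + dot eD (0 - u)))).
  have dD : mx_derive (fun s => Delta - Db s) t (0 - u).
    by apply: mx_deriveD; [exact: mx_derive_cst|exact: mx_deriveN].
  apply: is_deriveD_fun; last by apply: is_deriveM_fun; exact: is_derive_dot.
  apply: is_deriveD_fun; last first.
    apply: is_deriveM_fun; apply: is_derive_dot => //.
    exact: e_R_derive.
  apply: is_deriveD_fun; last by apply: is_deriveM_fun; exact: err_Psi_derive.
  by apply: is_deriveM_fun; exact: is_derive_dot.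
have JdwE := control_momentum Jdw; rewrite -/e -/eD in JdwE.
have -> : dot (dw t) (J *m w t) = dot (w t) (J *m dw t).
  by rewrite dotC dot_mulmxl hJ.1.
have uE : dot u eD = kDelta *
    (dot (w t) (W (Q t) (w t) *m eD) + c * dot e (W (Q t) (w t) *m eD)).
  by rewrite /u /update_law -/e dotZl dot_mulmxl trmxK dotDl (dotZl c e).
rewrite sub0r dotNl dotNr (dotC eD u) uE.
have de_le : dot (J *m w t) de <= lambdaM * H * enorm (w t) ^+ 2.
  apply: le_trans (ler_dot _ _) _.
  apply: le_trans (_ : (lambdaM * enorm (w t)) * (H * enorm (w t)) <= _); last by lra.
  rewrite ler_pM ?enorm_ge0//; first exact: ler_enorm_max_eigenvalue.
  exact: enorm_e_R_rate.
have we_le : - dot (w t) e <= enorm (w t) * enorm e.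
  by rewrite -(enormN e) -dotNr ler_dot.
have -> : f t = enorm (w t) ^+ 2 + enorm e ^+ 2 by [].
clearbody de eD; clearbody e.
rewrite JdwE [dot (_ + _) e]dotC !dotDr !dotNr !(dotZr kR) !(dotZr kOmega).
rewrite (dotC e (w t)) -!sqr_enorm.
apply: le_trans (hk (enorm (w t)) (enorm e)).
have := ler_wpM2l (ltW hc0) de_le.
have := ler_wpM2l (ltW (mulr_gt0 hc0 hkOmega)) we_le.
set x := enorm (w t); set y := enorm e; move: (dot (w t) e) => we.
move: (dot (w t) _) (dot e _) (dot _ de) => a b d h1 h2.
(* The work of [kR] in the potential cancels that in the control, and [a] and [b], the pairings of
   [w] and [e] with the uncertainty, cancel against the adaptation terms. *)
rewrite [X in X <= _](_ : _ =
  - kOmega * x ^+ 2 - c * kR * y ^+ 2 - c * kOmega * we + c * d).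
  lra.
by field; rewrite gt_eqF.
Qed.

Let admissible t : horizon T t -> SO3 (Q t) /\ rRv r v (Q t) < cos theta.
Proof. by case: hsys => adm _ _ _; exact: adm. Qed.

Let seg_horizon b x : horizon T b -> x \in `[0, b] -> horizon T x.
Proof.
move=> [b0 bT]; rewrite in_itv /= => /andP[x0 xb]; split=> //.
by apply: le_lt_trans bT; rewrite lee_fin.
Qed.

Lemma within_cvg m n (X dX : R -> 'M[R]_(m, n)) b x :
  solves_on T X dX -> horizon T b -> x \in `[0, b] ->
  mx_cvg (within `[0, b]%classic (nbhs x)) X (X x).
Proof.
move=> [cX _] hb xb i j.
have /subspace_continuousP : {within `[0, b], continuous (fun t => X t i j)}.
  by apply: continuous_subspaceW (cX i j) => y /= yb; exact: seg_horizon hb yb.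
exact.
Qed.

Lemma err_A_continuous b : horizon T b ->
  {within `[0, b], continuous (fun t => err_A g Rd (Q t))}.
Proof.
move=> hb; apply/subspace_continuousP => x /= xb; apply: cvg_err_A.
by case: hsys => _ hQ _ _; exact: within_cvg hQ hb xb.
Qed.

Lemma lyapunov_continuous b : horizon T b -> {within `[0, b], continuous V}.
Proof.
move=> hb; apply/subspace_continuousP => x /= xb.
have [_ Qx] := admissible (seg_horizon hb xb).
have [_ /within_cvg/(_ hb xb) cQ [dw /within_cvg/(_ hb xb) cw _]
  /within_cvg/(_ hb xb) cD] := hsys.
have cJ : mx_cvg (within `[0, b]%classic (nbhs x)) (fun s => J *m w s) (J *m w x).
  by apply: mx_cvgM; [exact: mx_cvg_cst|exact: cw].
have ceD : mx_cvg (within `[0, b]%classic (nbhs x))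
    (fun s => Delta - Db s) (Delta - Db x).
  by apply: mx_cvgD; [exact: mx_cvg_cst|exact: mx_cvgN].
apply: cvgD; last by apply: cvgM; [exact: cvg_cst|exact: cvg_dot].
apply: cvgD; last first.
  by apply: cvgM; [exact: cvg_cst|apply: cvg_dot => //; exact: mx_cvg_e_R].
apply: cvgD; last by apply: cvgM; [exact: cvg_cst|exact: cvg_err_Psi].
by apply: cvgM; [exact: cvg_cst|exact: cvg_dot].
Qed.

(** Membership in [D] is asked on the open interval only, which suits both the mean value theorem
    and an interval ending at a first exit time. *)
Lemma lyapunov_drop k :
  (forall x y : R,
    - (kOmega - c * lambdaM * H) * x ^+ 2 + c * kOmega * (x * y) - c * kR * y ^+ 2
    <= - k * (x ^+ 2 + y ^+ 2)) -> 0 < k ->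
  forall a b m, 0 <= a <= b -> horizon T b ->
    (forall s, a < s < b -> D (Q s) /\ m <= f s) ->
  V b <= V a - k * m * (b - a).
Proof.
move=> hk k0 a b m /andP[a0 ab] hb hs.
have dV s : s \in `]a, b[ -> exists2 dV, is_derive s 1 V dV & dV <= - k * m.
  rewrite in_itv /= => sab; have [Ds ms] := hs s sab; have /andP[as_ sb] := sab.
  have [||dV h1 h2] := lyapunov_derive hk _ _ Ds.
  - exact: le_lt_trans as_.
  - by case: hb => _; apply: lt_trans; rewrite lte_fin.
  by exists dV => //; apply: le_trans h2 _; rewrite ler_wnM2l// oppr_le0 ltW.
have [ab'|ba] := ltP a b; last by rewrite (@le_anti _ _ a b) ?ab// subrr mulr0 subr0.
have [|| s sab VE] := @MVT _ V (fun s => 'D_1 V s) a b ab'.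
- by move=> s sab; have [d [Vs _] _] := dV s sab; exact: derivableP.
- apply: continuous_subspaceW (lyapunov_continuous hb).
  by apply: subset_itvr; rewrite bnd_simp.
have [d Vd dm] := dV s sab.
have := @derive_val _ _ _ _ _ _ _ Vd => Vd'.
rewrite -lerBlDl VE Vd' -mulrN1 -mulrA [_ * -1]mulrC mulrA.
rewrite [leRHS](_ : _ = - k * m * (b - a)); last by ring.
by rewrite ler_wpM2r// subr_ge0.
Qed.

End Trajectory.

(** Completing the square: w . Jw / 2 + c Jw . e equals (w + c e) . J (w + c e) / 2 - c^2 e . Je /
    2. Coercivity bounds the first term from below, the largest eigenvalue the second. *)
Lemma ex_lyapunov_lower : exists2 m : R, 0 < m & forall Q w Db,
  m * dot (w + c *: eR Q) (w + c *: eR Q) - c ^+ 2 * lambdaM / 2 * dot (eR Q) (eR Q)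
  + kR * Psi Q + (2 * kDelta)^-1 * dot (Delta - Db) (Delta - Db)
  <= lyapunov Q w Db.
Proof.
have [m m0 hm] := pos_def_coercive hJ hlambdaM.
exists (2^-1 * m); first by rewrite mulr_gt0.
move=> Q w Db; rewrite /lyapunov; set e := eR Q.
move: ((2 * kDelta)^-1 * _) (kR * _) => z1 z2.
have h1 := hm (w + c *: e).
have h2 := ler_quad_form_max_eigenvalue e hJ.1 hlambdaM.
have h3 : dot (w + c *: e) (J *m (w + c *: e)) =
    dot w (J *m w) + 2 * c * dot (J *m w) e + c ^+ 2 * dot e (J *m e).
  clearbody e; rewrite mulmxDr -scalemxAr dotDl !dotDr !dotZl !dotZr.
  by rewrite (dotC e (J *m w)) (dot_mulmxl J) hJ.1; ring.
have := ler_wpM2l (sqr_ge0 c) h2; lra.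
Qed.

Lemma e_R_bound Q : D Q -> enorm (eR Q) <= bB * beA + bA * beB.
Proof.
move=> DQ; have [[A B eA eB] _] := hbounds DQ.
rewrite /e_R; apply: le_trans (ler_enormD _ _) _.
rewrite (enormZ (err_A _ _ _)) (enormZ (err_B _ _ _ _ _)).
by apply: lerD; apply: ler_pM => //; exact: enorm_ge0.
Qed.

Lemma err_Psi_ge0 Q : D Q -> 0 <= Psi Q.
Proof.
move=> [sQ [_ Qb]]; have Qc := lt_trans Qb hbeta.
by apply: le_trans (err_Psi_ge_A hr hv htheta halpha hg hRd sQ Qc); exact: err_A_ge0.
Qed.

Lemma sqr_e_R_bound Q : D Q -> dot (eR Q) (eR Q) <= (bB * beA + bA * beB) ^+ 2.
Proof.
move=> DQ; rewrite -sqr_enorm; have h := e_R_bound DQ.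
by rewrite ler_pXn2r ?nnegrE ?enorm_ge0// (le_trans (enorm_ge0 _) h).
Qed.

Lemma enorm_le1D n (x : 'cV[R]_n) : enorm x <= 1 + dot x x.
Proof.
rewrite -sqr_enorm; have := sqr_ge0 (enorm x - 1); have := sqr_ge0 (enorm x).
lra.
Qed.

Lemma lyapunov_bounded_below : exists C : R, forall Q w Db, D Q -> C <= lyapunov Q w Db.
Proof.
have [m m0 hm] := ex_lyapunov_lower.
exists (- (c ^+ 2 * lambdaM / 2 * (bB * beA + bA * beB) ^+ 2)) => Q w Db DQ.
apply: le_trans (hm Q w Db).
have a0 : 0 <= c ^+ 2 * lambdaM / 2 by rewrite divr_ge0// mulr_ge0 ?sqr_ge0// ltW.
have := ler_wpM2l a0 (sqr_e_R_bound DQ).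
have := mulr_ge0 (ltW hkR) (err_Psi_ge0 DQ).
have := mulr_ge0 (ltW m0) (dot_ge0 (w + c *: eR Q)).
have : 0 <= (2 * kDelta)^-1 * dot (Delta - Db) (Delta - Db).
  by rewrite mulr_ge0 ?dot_ge0// invr_ge0 mulr_ge0// ltW.
lra.
Qed.

Lemma lyapunov_sublevel_bounded (B0 : R) : exists K : R,
  forall Q w Db, D Q -> lyapunov Q w Db <= B0 ->
    enorm w <= K /\ enorm (Delta - Db) <= K.
Proof.
have [m m0 hm] := ex_lyapunov_lower.
pose bR := (bB * beA + bA * beB) ^+ 2.
pose S := B0 + c ^+ 2 * lambdaM / 2 * bR.
have bR0 : 0 <= bR by exact: sqr_ge0.
have c2 : 0 <= c ^+ 2 * bR by rewrite mulr_ge0 ?sqr_ge0.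
(* A sum of nonnegative bounds that serves both norms, the 1 coming from |x| <= 1 + |x|^2. *)
exists (1 + `|m^-1 * S| * 2 + 2 * (c ^+ 2 * bR) + `|2 * kDelta * S|) => Q w Db DQ VB.
have := le_trans (hm Q w Db) VB; set e := eR Q; set eD := Delta - Db => h.
have eb : dot e e <= bR by exact: sqr_e_R_bound.
have a0 : 0 <= c ^+ 2 * lambdaM / 2 by rewrite divr_ge0// mulr_ge0 ?sqr_ge0// ltW.
have h1 := ler_wpM2l a0 eb.
have h2 := mulr_ge0 (ltW hkR) (err_Psi_ge0 DQ).
have h3 := mulr_ge0 (ltW m0) (dot_ge0 (w + c *: e)).
have h4 : 0 <= (2 * kDelta)^-1 * dot eD eD.
  by rewrite mulr_ge0 ?dot_ge0// invr_ge0 mulr_ge0// ltW.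
have wS : dot (w + c *: e) (w + c *: e) <= m^-1 * S.
  by rewrite mulrC ler_pdivlMr// mulrC /S; lra.
have DS : dot eD eD <= 2 * kDelta * S.
  by rewrite -ler_pdivrMl ?mulr_gt0// /S; lra.
have n1 := ler_norm (m^-1 * S); have n2 := ler_norm (2 * kDelta * S).
have n3 := normr_ge0 (m^-1 * S); have n4 := normr_ge0 (2 * kDelta * S).
have h5 := sqr_enorm_leD w (c *: e); rewrite (dot_scale c e) in h5.
have h6 := ler_wpM2l (sqr_ge0 c) eb.
split; first by have := enorm_le1D w; lra.
by have := enorm_le1D eD; lra.
Qed.

Lemma lyapunov_nonincreasing T Q w Db : sys T Q w Db ->
  (forall t, horizon T t -> D (Q t)) -> forall t, horizon T t ->
  lyapunov (Q t) (w t) (Db t) <= lyapunov (Q 0) (w 0) (Db 0).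
Proof.
move=> hsys DQ t ht; have [k k0 hk] := ex_decay_rate.
have [t0 tT] := ht.
have := @lyapunov_drop _ _ _ _ hsys _ hk k0 0 t 0 _ ht.
rewrite lexx t0 mulr0 mul0r subr0; apply=> // s /andP[s0 st]; split.
  by apply: DQ; split; rewrite ?(ltW s0)// (le_lt_trans _ tT)// lee_fin ltW.
by rewrite addr_ge0 ?sqr_ge0.
Qed.

Lemma sqr_error_vector Q w Db : dot (err Q w Db) (err Q w Db) =
  dot (eR Q) (eR Q) + (dot w w + dot (Delta - Db) (Delta - Db)).
Proof.
have dcol m n (x : 'cV[R]_m) (y : 'cV[R]_n) :
    dot (col_mx x y) (col_mx x y) = dot x x + dot y y.
  by rewrite /dot big_split_ord; congr (_ + _); apply: eq_bigr => i _;
     rewrite ?col_mxEu ?col_mxEd.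
by rewrite /error_vector !dcol.
Qed.

Lemma error_vector_parts Q w Db (a : R) : enorm (err Q w Db) <= a ->
  [/\ 0 <= a, dot (eR Q) (eR Q) <= a ^+ 2, dot w w <= a ^+ 2 &
      dot (Delta - Db) (Delta - Db) <= a ^+ 2].
Proof.
move=> ha; have a0 := le_trans (enorm_ge0 _) ha.
have : enorm (err Q w Db) ^+ 2 <= a ^+ 2 by rewrite ler_pXn2r ?nnegrE ?enorm_ge0.
rewrite sqr_enorm sqr_error_vector.
have := dot_ge0 (eR Q); have := dot_ge0 w; have := dot_ge0 (Delta - Db).
by split=> //; lra.
Qed.

(* [dot (J w) e <= lambdaM (|w|^2 + |e|^2) / 2]. *)
Lemma lyapunov_upper Q w Db : lyapunov Q w Db <=
  lambdaM / 2 * dot w w + kR * Psi Q +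
  c * (lambdaM / 2 * (dot w w + dot (eR Q) (eR Q))) +
  (2 * kDelta)^-1 * dot (Delta - Db) (Delta - Db).
Proof.
rewrite /lyapunov; set e := eR Q; rewrite lerD2r.
have h1 := ler_quad_form_max_eigenvalue w hJ.1 hlambdaM.
have h2 : dot (J *m w) e <= lambdaM / 2 * (dot w w + dot e e).
  apply: le_trans (ler_dot _ _) _.
  apply: le_trans (_ : lambdaM * enorm w * enorm e <= _).
    by rewrite ler_wpM2r ?enorm_ge0//; exact: ler_enorm_max_eigenvalue.
  have := ler_wpM2l (ltW l0) (sqr_ge0 (enorm w - enorm e)).
  by rewrite -!sqr_enorm; lra.
have := ler_wpM2l (ltW hc0) h2; lra.
Qed.

(** The bound is uniform in the trajectory and the horizon: [a] and [psi] limit the initial value of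
    V, which does not increase, and sublevel sets of V bound the estimation error. *)
Lemma estimate_bounded (a : R) : exists M : R,
  forall T Q w Db, sys T Q w Db -> (forall t, horizon T t -> D (Q t)) ->
    enorm (err (Q 0) (w 0) (Db 0)) <= a ->
    forall t, horizon T t -> enorm (Db t) <= M.
Proof.
pose B0 := lambdaM / 2 * a ^+ 2 + kR * psi +
  c * (lambdaM / 2 * (a ^+ 2 + a ^+ 2)) + (2 * kDelta)^-1 * a ^+ 2.
have [K hK] := lyapunov_sublevel_bounded B0.
exists (enorm Delta + K) => T Q w Db hsys DQ err0 t ht.
have h0 : horizon T 0.
  by case: ht => t0 tT; split=> //; rewrite (le_lt_trans _ tT)// lee_fin.
have [a0 eRa wa eDa] := error_vector_parts err0.
have V0 : lyapunov (Q 0) (w 0) (Db 0) <= B0.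
  apply: le_trans (lyapunov_upper _ _ _) _; rewrite !lerD//.
  - by rewrite ler_wpM2l// divr_ge0// ltW.
  - by rewrite ler_pM2l//; have [_ [/ltW]] := DQ 0 h0.
  - by rewrite ler_pM2l// ler_wpM2l ?lerD// divr_ge0// ltW.
  - by rewrite ler_wpM2l// invr_ge0 mulr_ge0// ltW.
have [_ eDK] := hK _ _ _ (DQ t ht) (le_trans (lyapunov_nonincreasing hsys DQ ht) V0).
rewrite -[Db t](subKr Delta) (le_trans (ler_enormD _ _))// enormN lerD2l//.
Qed.

(** The limit refers to the canonical max norm, which the Euclidean norm dominates. *)
Lemma cvg0_dot (x : R -> 'cV[R]_3) :
  (forall e, 0 < e -> exists2 N, 0 < N & forall t, N <= t -> dot (x t) (x t) < e) ->
  x t @[t --> +oo] --> (0 : 'cV[R]_3).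
Proof.
move=> hx; apply/cvgr0Pnorm_lt => e e0.
have [N _ hN] := hx (e ^+ 2) (exprn_gt0 2 e0).
exists N; split; first exact: num_real.
move=> t /ltW/hN; rewrite -sqr_enorm ltr_pXn2r ?nnegrE ?enorm_ge0 ?(ltW e0)// => xe.
have : ball (0 : 'cV[R]_3) e (x t).
  split=> // i j; rewrite ord1 mxE -ball_normE /ball_ /= sub0r normrN.
  exact: le_lt_trans (ler_entry_enorm _ _) xe.
by rewrite mx_norm_ball /ball_ /= sub0r normrN.
Qed.

(** [dissipation_cvg0] plays the part of Barbalat's lemma. Its Lipschitz condition comes from a
    bounded acceleration: [w] and the estimation error are bounded by the sublevel set of V, [e_R]
    by the domain, and the regressor by [BW]. *)
Lemma error_convergence Q w Db : sys +oo%E Q w Db ->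
  (forall t, 0 <= t -> D (Q t)) ->
  (eR (Q t) @[t --> +oo] --> (0 : 'cV[R]_3)) /\
  (w t @[t --> +oo] --> (0 : 'cV[R]_3)).
Proof.
move=> hsys DQ.
have hz (t : R) : 0 <= t -> horizon +oo%E t by move=> t0; split=> //; exact: ltry.
have DQ' t : horizon +oo%E t -> D (Q t) by case=> t0 _; exact: DQ.
pose f t := enorm (w t) ^+ 2 + enorm (eR (Q t)) ^+ 2.
pose V t := lyapunov (Q t) (w t) (Db t).
have [k k0 hk] := ex_decay_rate.
have [C hC] := lyapunov_bounded_below.
have [K hK] := lyapunov_sublevel_bounded (V 0).
have [adm [_ dQ] [dw [_ dwE] Jdw] _] := hsys.
have bK (t : R) : 0 <= t -> enorm (w t) <= K /\ enorm (Delta - Db t) <= K.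
  by move=> t0; apply: hK (DQ t t0) _; exact: (lyapunov_nonincreasing hsys DQ' (hz t t0)).
have K0 : 0 <= K by have [+ _] := bK 0 (lexx 0); exact: le_trans (enorm_ge0 _).
have BW0 : 0 <= BW := le_trans (norm2_ge0 _) (hW (w 0) (DQ 0 (lexx 0)).1).
pose bR := bB * beA + bA * beB.
have eRb (t : R) : 0 <= t -> enorm (eR (Q t)) <= bR.
  by move=> t0; exact: e_R_bound (DQ t t0).
have bR0 : 0 <= bR := le_trans (enorm_ge0 _) (eRb 0 (lexx 0)).
pose N := norm2 (invmx J).
have N0 : 0 <= N by exact: norm2_ge0.
pose b := N * (kR * bR + kOmega * K + BW * K).
have b0 : 0 <= b.
  by apply: mulr_ge0 => //; rewrite !addr_ge0// mulr_ge0// ltW.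
have dwb (t : R) : 0 < t -> enorm (dw t) <= b.
  move=> t0; have [wK eDK] := bK t (ltW t0).
  rewrite -[dw t](mulKmx (pos_def_unitmx hJ)).
  apply: le_trans (ler_norm2 _ _) _; rewrite ler_wpM2l//.
  rewrite (control_momentum (Jdw t t0 (ltry _))).
  apply: le_trans (ler_enormD _ _) _; apply: lerD.
    apply: le_trans (ler_enormD _ _) _; rewrite !enormN.
    rewrite (enormZ kR) (enormZ kOmega) !gtr0_norm//.
    by apply: lerD; rewrite ler_pM2l//; exact: eRb (ltW t0).
  apply: le_trans (ler_norm2 _ _) _; apply: ler_pM => //; first exact: norm2_ge0.
    exact: enorm_ge0.
  by apply: hW; have [] := DQ t (ltW t0).
(* The two products bound the rates of |w|^2 and |e_R|^2; the 1 makes [L] positive. *)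
pose L := 2 * (b * K) + 2 * (H * K * bR) + 1.
have L0 : 0 < L.
  rewrite ltr_pwDr// addr_ge0// mulr_ge0// mulr_ge0//.
  by rewrite mulr_ge0// ltW.
have df (t : R) : 0 < t -> exists2 d, is_derive t 1 f d & `|d| <= L.
  move=> t0; have t0' := ltW t0.
  have DQt := DQ t t0'; have [sQ Qc] := adm t (hz t t0').
  have -> : f = (fun s => dot (w s) (w s) + dot (eR (Q s)) (eR (Q s))).
    by apply/funext => s; rewrite /f !sqr_enorm.
  pose de := e_R_rate r v theta alpha g Rd (Q t) (w t).
  exists (dot (dw t) (w t) + dot (w t) (dw t) + (dot de (eR (Q t)) + dot (eR (Q t)) de)).
    have dwt : mx_derive w t (dw t) by exact: dwE t t0 (ltry _).
    have det : mx_derive (fun s => eR (Q s)) t de.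
      by apply: e_R_derive => //; exact: dQ t t0 (ltry _).
    by apply: is_deriveD_fun; exact: is_derive_dot.
  rewrite (dotC (w t)) (dotC (eR (Q t))).
  have h1 : `|dot (dw t) (w t)| <= b * K.
    apply: le_trans (ler_norm_dot _ _) _; apply: ler_pM; rewrite ?enorm_ge0//.
      exact: dwb.
    by have [] := bK t t0'.
  have h2 : `|dot de (eR (Q t))| <= H * K * bR.
    apply: le_trans (ler_norm_dot _ _) _; apply: ler_pM; rewrite ?enorm_ge0//.
      apply: le_trans (enorm_e_R_rate _ DQt) _.
      by rewrite ler_pM2l//; have [] := bK t t0'.
    exact: eRb.
  move: h1 h2; rewrite !ler_norml => /andP[? ?] /andP[? ?].
  by apply/andP; rewrite /L; split; lra.
have lip (s t : R) : 0 < s <= t -> `|f t - f s| <= L * (t - s).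
  move=> /andP[s0 st].
  have st0 (u : R) : s <= u -> 0 < u by exact: lt_le_trans.
  have [|| u uI ->] := @MVT_segment _ f (fun u => 'D_1 f u) s t st.
  - move=> u; rewrite in_itv /= => /andP[su _].
    by have [d [fd _] _] := df u (st0 u (ltW su)); exact: derivableP.
  - apply/subspace_continuousP => u; rewrite /= in_itv /= => /andP[su _].
    have [d [fd _] _] := df u (st0 u su); apply: cvg_within_filter.
    by apply: differentiable_continuous; apply/derivable1_diffP.
  move: uI; rewrite in_itv /= => /andP[su _].
  have [d fd dL] := df u (st0 u su).
  rewrite (@derive_val _ _ _ _ _ _ _ fd) normrM [`|t - s|]ger0_norm ?subr_ge0//.
  by rewrite ler_wpM2r// subr_ge0.
have f0 (t : R) : 0 <= f t by rewrite addr_ge0 ?sqr_ge0.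
have drop (a a' m : R) : 0 <= a <= a' -> (forall s, a < s < a' -> m <= f s) ->
    V a' <= V a - k * m * (a' - a).
  move=> /andP[a0 aa'] hm.
  apply: (lyapunov_drop hsys hk k0); rewrite ?a0//; first exact: hz (le_trans a0 aa').
  move=> s ss; split; last exact: hm.
  by apply: DQ; case/andP: ss => /ltW/(le_trans a0).
have f_cvg := dissipation_cvg0 k0 L0 drop (fun t t0 => hC _ _ _ (DQ t t0)) lip f0.
split; apply: cvg0_dot => e e0; have [N' N'0 hN] := f_cvg e e0;
  exists N' => // t /hN; apply: le_lt_trans;
  by rewrite /f !sqr_enorm ?lerDl ?lerDr dot_ge0.
Qed.

(** [rho] depends only on the level [eta] of the local estimates. Shrinking [eps] affects the
    initial error alone. *)
Lemma error_stability : exists2 rho : R, 0 < rho & forall eps : R, 0 < eps ->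
  exists2 delta : R, 0 < delta & forall T Q w Db,
    sys T Q w Db -> D (Q 0) -> norm2 (Q 0 - Rd) < rho ->
    enorm (err (Q 0) (w 0) (Db 0)) < delta ->
    forall t, horizon T t -> D (Q t) /\ enorm (err (Q t) (w t) (Db t)) < eps.
Proof.
have c2l : 0 < c ^+ 2 * lambdaM by rewrite mulr_gt0// exprn_gt0.
(* Midpoint of the interval opened by [gain_sqr]: above [H] for the local estimate, below the other
   end so that [mu] is positive. *)
pose H' := (H + kR / (c ^+ 2 * lambdaM)) / 2.
have gap : H < kR / (c ^+ 2 * lambdaM) by rewrite ltr_pdivlMr// mulrC gain_sqr.
have HH' : H < H' by rewrite /H'; lra.
have H'0 : 0 < H' by exact: lt_trans HH'.
pose mu := kR - c ^+ 2 * lambdaM * H'.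
have mu0 : 0 < mu.
  have : c ^+ 2 * lambdaM * H' < c ^+ 2 * lambdaM * (kR / (c ^+ 2 * lambdaM)).
    by rewrite ltr_pM2l// /H'; lra.
  rewrite [X in _ < X -> _]mulrC divfK ?gt_eqF// /mu; lra.
have [eta [Ca [eta0 Ca0 loc]]] :=
  local_estimates hr hv htheta halpha hg hRd hbeta hD hbounds hH HH'.
have [rho rho0 hrho] := ex_radius hg hRd eta0.
have [m m0 hm] := ex_lyapunov_lower.
exists rho => // eps eps0.
(* The summands of [C1] bound |e_R|^2, |w|^2 and |e_Delta|^2 by V; the middle one recovers [w] from
   w + c e_R. *)
pose C1 := 2 * H' / mu + (2 / m + 2 * c ^+ 2 * (2 * H' / mu)) + 2 * kDelta.
pose C2 := lambdaM / 2 + kR * bB * Ca + c * lambdaM + (2 * kDelta)^-1.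
have kD0 : 0 < (2 * kDelta)^-1 by rewrite invr_gt0 mulr_gt0.
have bB0 : 0 < bB.
  have /andP[B1 Bb] := err_B_bounds hr hv htheta halpha hbeta hbounds hD.
  by rewrite (lt_le_trans ltr01)// (le_trans B1).
have C20 : 0 < C2.
  rewrite /C2 !addr_gt0// ?mulr_gt0// ?divr_gt0//.
have C10 : 0 < C1.
  have q0 : 0 < 2 * H' / mu by rewrite divr_gt0// mulr_gt0.
  have q1 : 0 < 2 / m by rewrite divr_gt0.
  have q2 : 0 < 2 * c ^+ 2 * (2 * H' / mu) by rewrite mulr_gt0// mulr_gt0// exprn_gt0.
  by rewrite /C1 !addr_gt0// mulr_gt0.
(* On the sublevel set [err_A <= eta] the Lyapunov function and the squared
   error norm are equivalent. *)
have lower Q w Db : SO3 Q -> err_A g Rd Q <= eta ->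
    mu * err_A g Rd Q <= lyapunov Q w Db /\
    dot (err Q w Db) (err Q w Db) <= C1 * lyapunov Q w Db.
  move=> sQ Aeta; have [DQ eRPsi ACa] := loc Q sQ Aeta.
  have [_ [_ Qb]] := DQ; have Qc := lt_trans Qb hbeta.
  have APsi := err_Psi_ge_A hr hv htheta halpha hg hRd sQ Qc.
  have A0 := err_A_ge0 hg hRd sQ.
  have := hm Q w Db; set V := lyapunov Q w Db; set e := eR Q in eRPsi *.
  set eD := Delta - Db => hV.
  rewrite sqr_error_vector -/e -/eD.
  clearbody e eD V.
  have we0 := dot_ge0 (w + c *: e); have eD0 := dot_ge0 eD.
  have ee0 := dot_ge0 e.
  have mPsi : mu * Psi Q <= kR * Psi Q - c ^+ 2 * lambdaM / 2 * dot e e.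
    have := ler_wpM2l (ltW c2l) eRPsi; rewrite /mu; lra.
  have t1 := mulr_ge0 (ltW m0) we0; have t2 := mulr_ge0 (ltW kD0) eD0.
  have t3 := mulr_ge0 (ltW mu0) (le_trans A0 APsi).
  have PsiV : Psi Q <= V / mu by rewrite ler_pdivlMr// mulrC; lra.
  have eV : dot e e <= 2 * H' / mu * V.
    apply: le_trans eRPsi _.
    have -> : 2 * H' / mu * V = 2 * H' * (V / mu) by rewrite mulrAC mulrA.
    by rewrite ler_pM2l// mulr_gt0.
  have weV : dot (w + c *: e) (w + c *: e) <= m^-1 * V.
    by rewrite mulrC ler_pdivlMr// mulrC; lra.
  have eDV : dot eD eD <= 2 * kDelta * V by rewrite -ler_pdivrMl ?mulr_gt0//; lra.
  have wV := sqr_enorm_leD w (c *: e); rewrite (dot_scale c e) in wV.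
  split; first by have := ler_wpM2l (ltW mu0) APsi; lra.
  have := ler_wpM2l (sqr_ge0 c) eV; rewrite /C1; lra.
have upper Q w Db : SO3 Q -> err_A g Rd Q <= eta ->
    lyapunov Q w Db <= C2 * dot (err Q w Db) (err Q w Db).
  move=> sQ Aeta; have [DQ _ ACa] := loc Q sQ Aeta.
  apply: le_trans (lyapunov_upper _ _ _) _; rewrite sqr_error_vector.
  have A0 := err_A_ge0 hg hRd sQ.
  have PsiE : Psi Q <= bB * (Ca * dot (eR Q) (eR Q)).
    have /andP[B1 Bb] := err_B_bounds hr hv htheta halpha hbeta hbounds DQ.
    by rewrite /err_Psi mulrC; apply: ler_pM => //; exact: le_trans B1.
  have kPsi := ler_wpM2l (ltW hkR) PsiE.
  have ee0 := dot_ge0 (eR Q); have ww0 := dot_ge0 w; have dd0 := dot_ge0 (Delta - Db).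
  move: (dot (eR Q) _) (dot w w) (dot (Delta - Db) _) kPsi ee0 ww0 dd0.
  move=> x y z kPsi x0 y0 z0.
  have p1 : 0 <= lambdaM * x by rewrite mulr_ge0// ltW.
  have p2 : 0 <= lambdaM * z by rewrite mulr_ge0// ltW.
  have p3 : 0 <= kR * bB * Ca * (y + z).
    by apply: mulr_ge0; [rewrite ltW// !mulr_gt0|rewrite addr_ge0].
  have p4 : 0 <= (2 * kDelta)^-1 * (x + y) by rewrite mulr_ge0 ?addr_ge0// ltW.
  have p5 : 0 <= c * lambdaM * (x / 2 + y / 2 + z).
    by apply: mulr_ge0; [rewrite ltW// mulr_gt0|rewrite !addr_ge0 ?divr_ge0].
  rewrite /C2; lra.
(* The first constraint keeps V below the value forced by [err_A = eta], the second makes the errors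
   smaller than [eps], and the third replaces the square of [delta] by [delta]. *)
have [|delta delta0 small] :=
  @ex_small _ [:: (C2, mu * eta); (C1 * C2, eps ^+ 2); (1, 1)].
  move=> cd; rewrite !inE => /or3P[/eqP->|/eqP->|/eqP->] //=.
    by rewrite mulr_gt0.
  by rewrite exprn_gt0.
have s1 : C2 * delta < mu * eta by apply: (small (C2, mu * eta)); rewrite !inE eqxx.
have s2 : C1 * C2 * delta < eps ^+ 2.
  by apply: (small (C1 * C2, eps ^+ 2)); rewrite !inE eqxx ?orbT.
have s3 : 1 * delta < 1 by apply: (small (1, 1)); rewrite !inE eqxx ?orbT.
exists delta => // T Q w Db hsys DQ0 Q0rho err0 t ht.
have [adm _ _ _] := hsys.
have [t0 tT] := ht.
have hz (s : R) : 0 <= s <= t -> horizon T s.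
  by move=> /andP[s0 st]; split=> //; rewrite (le_lt_trans _ tT)// lee_fin.
have h0 : horizon T 0 by apply: hz; rewrite lexx.
have sQ (s : R) : 0 <= s <= t -> SO3 (Q s) by move=> /hz/adm[].
have A0 : err_A g Rd (Q 0) < eta by apply: hrho => //; exact: (adm 0 h0).1.
pose V s := lyapunov (Q s) (w s) (Db s).
have V0 : V 0 <= C2 * delta.
  apply: le_trans (upper _ _ _ (adm 0 h0).1 (ltW A0)) _.
  rewrite ler_pM2l// -sqr_enorm expr2.
  have := ler_pM (enorm_ge0 _) (enorm_ge0 _) (ltW err0) (ltW err0) => /le_trans; apply.
  by rewrite ler_piMl ?(ltW delta0)//; lra.
(* V decreases only inside [D], which is known only while [err_A < eta]. [trapped] breaks the circle
   at a first time with equality, where mu eta <= V <= C2 delta would contradict the choice of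
   [delta]. *)
have decr (s : R) : 0 <= s <= t -> (forall u, 0 <= u < s -> err_A g Rd (Q u) < eta) ->
    V s <= V 0.
  move=> /andP[s0 st] As; have [k k0 hk] := ex_decay_rate.
  have := @lyapunov_drop _ _ _ _ hsys _ hk k0 0 s 0 _ (hz s _).
  rewrite lexx s0 st mulr0 mul0r subr0; apply=> // u /andP[u0 us]; split.
    have uA : err_A g Rd (Q u) < eta by apply: As; rewrite (ltW u0).
    have su : SO3 (Q u) by apply: sQ; rewrite (ltW u0) (le_trans (ltW us)).
    by have [] := loc _ su (ltW uA).
  by rewrite addr_ge0 ?sqr_ge0.
have trapped (s : R) : 0 <= s <= t -> err_A g Rd (Q s) < eta.
  move=> /andP[s0 st]; rewrite ltNge; apply/negP => As.
  have hs : horizon T s by apply: hz; rewrite s0.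
  have [u [/andP[u0 us] Au before]] := first_exit s0 (err_A_continuous hsys hs) A0 As.
  have ut : 0 <= u <= t by rewrite u0 (le_trans us).
  have Au' : err_A g Rd (Q u) <= eta by rewrite Au.
  have [+ _] := lower (Q u) (w u) (Db u) (sQ u ut) Au'.
  rewrite Au; have := decr u ut before; rewrite /V in V0 *; lra.
have tt : 0 <= t <= t by rewrite t0 lexx.
have At := trapped t tt.
have [Dt _ _] := loc _ (sQ t tt) (ltW At).
split=> //.
have [_ errV] := lower (Q t) (w t) (Db t) (sQ t tt) (ltW At).
have Vt : V t <= V 0.
  by apply: decr => // u /andP[u0 ut]; apply: trapped; rewrite u0 ltW.
rewrite -(@ltr_pXn2r _ 2) ?nnegrE ?enorm_ge0 ?(ltW eps0)// sqr_enorm.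
apply: le_lt_trans errV _; apply: le_lt_trans s2.
rewrite -mulrA ler_pM2l//; exact: le_trans Vt V0.
Qed.

Lemma error_equilibrium : rRv r v Rd < cos theta ->
  err Rd 0 Delta = 0 /\ sys +oo%E (fun=> Rd) (fun=> 0) (fun=> Delta).
Proof.
move=> Rdc.
have eR0 : eR Rd = 0.
  have A0 : err_A g Rd Rd = 0.
    by rewrite /err_A SO3_mulTmx// subrr mulmx0 linear0 mulr0.
  have eA0 : e_RA g Rd Rd = 0.
    rewrite /e_RA -mulmxA !SO3_mulTmx// mulmx1 mul1mx subrr.
    by apply: cV3P; rewrite !coordE !mxE mulr0.
  by rewrite /e_R A0 eA0 scaler0 scale0r addr0.
have cst m n (A : 'M[R]_(m, n)) : solves_on +oo%E (fun=> A) (fun=> 0).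
  split=> [i j|t _ _]; last exact: mx_derive_cst.
  by move=> x; exact: cvg_cst.
split; first by rewrite /error_vector eR0 subrr !col_mx0.
split.
- by [].
- have -> : (fun t : R => Rd *m hat (0 : 'cV[R]_3)) = fun=> 0.
    apply/funext => _; rewrite (_ : hat 0 = 0) ?mulmx0//.
    by apply: mx3P; split; rewrite !coordE !mxE ?oppr0.
  exact: cst.
- exists (fun=> 0); first exact: cst.
  by move=> t _ _; rewrite /control eR0 !mulmx0 !scaler0 !oppr0 !add0r subrK.
- have -> : (fun t : R => update_law g Rd r v theta alpha W kDelta c Rd 0) = fun=> 0.
    by apply/funext => _; rewrite /update_law eR0 scaler0 addr0 mulmx0 scaler0.
  exact: cst.
Qed.

End ClosedLoopStability.

Theorem proposition5 (R : realType)
  (* plant *)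
  (p : nat) (J : 'M[R]_3) (lambdaM : R)
  (W : 'M[R]_3 -> 'cV[R]_3 -> 'M[R]_(3, p)) (Delta : 'cV[R]_p) (BW BDelta : R)
  (hJ : pos_def J) (hlambdaM : max_eigenvalue J lambdaM)
  (hW : forall (Q : 'M[R]_3) (w : 'cV[R]_3), SO3 Q -> norm2 (W Q w) <= BW)
  (hDelta : enorm Delta <= BDelta)
  (* constraint, weights and desired attitude *)
  (r v : 'cV[R]_3) (theta alpha : R) (g : 'rV[R]_3) (Rd : 'M[R]_3)
  (hr : enorm r = 1) (hv : enorm v = 1)
  (htheta : 0 <= theta <= pi / 2) (halpha : 0 < alpha)
  (hg : forall i : 'I_3, 0 < g 0 i)
  (hg_distinct : forall i j : 'I_3, i != j -> g 0 i != g 0 j)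
  (hRd : SO3 Rd) (hRd_adm : rRv r v Rd < cos theta)
  (* domain about the desired attitude *)
  (psi beta : R) (hpsi : psi < h1 g) (hbeta : beta < cos theta)
  (hD : dom_D g Rd r v theta alpha psi beta Rd)
  (* constant upper bounds over the domain, and H *)
  (bA bB beA beB bE bF H : R)
  (hbounds : forall Q : 'M[R]_3, dom_D g Rd r v theta alpha psi beta Q ->
     [/\ `|err_A g Rd Q| <= bA, `|err_B r v theta alpha Q| <= bB,
         enorm (e_RA g Rd Q) <= beA & enorm (e_RB r v theta alpha Q) <= beB] /\
     (norm2 (mat_E g Rd Q) <= bE /\ norm2 (mat_F r v theta alpha Q) <= bF))
  (hH : H = bB * bE + 2 * beA * beB + bA * bF)
  (* gains *)
  (kR kOmega kDelta c : R)
  (hkR : 0 < kR) (hkOmega : 0 < kOmega) (hkDelta : 0 < kDelta)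
  (hc0 : 0 < c)
  (hc : c < 4 * kR * kOmega / (kOmega ^+ 2 + 4 * kR * lambdaM * H)) :
  let D := dom_D g Rd r v theta alpha psi beta in
  let sys := closed_loop g Rd r v theta alpha J W Delta kR kOmega kDelta c in
  let err := error_vector g Rd r v theta alpha Delta in
  [/\ (* the zero of the error vectors, at the desired attitude, is an equilibrium *)
      err Rd 0 Delta = 0 /\
      sys +oo%E (fun=> Rd) (fun=> 0) (fun=> Delta),
      (* which is stable in the sense of Lyapunov *)
      exists2 rho : R, 0 < rho & forall eps : R, 0 < eps ->
        exists2 delta : R, 0 < delta &
          forall (T : \bar R) (Q : R -> 'M[R]_3) (w : R -> 'cV[R]_3)
                 (Db : R -> 'cV[R]_p),
            sys T Q w Db -> D (Q 0) -> norm2 (Q 0 - Rd) < rho ->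
            enorm (err (Q 0) (w 0) (Db 0)) < delta ->
            forall t, horizon T t ->
              D (Q t) /\ enorm (err (Q t) (w t) (Db t)) < eps,
      (* e_R and e_Omega converge to zero *)
      forall (Q : R -> 'M[R]_3) (w : R -> 'cV[R]_3) (Db : R -> 'cV[R]_p),
        sys +oo%E Q w Db -> (forall t, 0 <= t -> D (Q t)) ->
        (e_R g Rd r v theta alpha (Q t) @[t --> +oo] --> (0 : 'cV[R]_3)) /\
        (w t @[t --> +oo] --> (0 : 'cV[R]_3))
    & (* the estimate is uniformly bounded *)
      forall a : R, exists M : R,
        forall (T : \bar R) (Q : R -> 'M[R]_3) (w : R -> 'cV[R]_3)
               (Db : R -> 'cV[R]_p),
          sys T Q w Db -> (forall t, horizon T t -> D (Q t)) ->
          enorm (err (Q 0) (w 0) (Db 0)) <= a ->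
          forall t, horizon T t -> enorm (Db t) <= M].
Proof.
split.
- exact: (error_equilibrium J W Delta alpha g hRd kR kOmega kDelta c hRd_adm).
- exact: (error_stability W Delta hJ hlambdaM hr hv htheta halpha hg hRd hbeta
    hD hbounds hH hkR hkOmega hkDelta hc0 hc).
- exact: (error_convergence hJ hlambdaM hW hr hv htheta halpha hg hRd hbeta hD
    hbounds hH hkR hkOmega hkDelta hc0 hc).
- exact: (estimate_bounded W Delta hJ hlambdaM hr hv htheta halpha hg hRd hbeta
    hD hbounds hH hkR hkOmega hkDelta hc0 hc).
Qed.
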